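(* Let $R$ be a commutative ring, $I\trianglelefteq R$ an ideal with $\mathrm{sr}(I)\leqslant 2$, and let $\ell\geqslant 4$. Then the group $\mathrm{Epin}(2\ell,R,I)=\mathrm{E}(\mathsf{D}_\ell,R,I)$ is a product of at most $9$ regularly embedded subgroups of type $\mathsf{A}_{\ell-1}$; that is, there are $m\leqslant 9$ and regularly embedded subgroups $H_1,\ldots,H_m$ of type $\mathsf{A}_{\ell-1}$ such that $\mathrm{E}(\mathsf{D}_\ell,R,I)=H_1\cdot H_2\cdots H_m$ as a product of sets.
   Context: $\mathrm{G}(\mathsf{D}_\ell,R)$ is the simply connected Chevalley group of type $\mathsf{D}_\ell$ over $R$ (the spin group), with elementary root unipotents $x_\alpha(\xi)$. For a root subsystem $\Delta\subseteq\Phi=\mathsf{D}_\ell$ (including $\Delta=\Phi$), $\mathrm{E}(\Delta,R)$ is the subgroup generated by all $x_\alpha(\xi)$, $\alpha\in\Delta$, $\xi\in R$, and $\mathrm{E}(\Delta,R,I)$ is the normal closure in $\mathrm{E}(\Delta,R)$ of the subgroup generated by all $x_\alpha(s)$, $\alpha\in\Delta$, $s\in I$. A regularly embedded subgroup of type $\mathsf{A}_{\ell-1}$ is a conjugate, by an element of $\mathrm{E}(\mathsf{D}_\ell,R)$, of a subgroup $\mathrm{E}(\Delta,R,I)$, where $\Delta\subset\mathsf{D}_\ell$ is a root subsystem of type $\mathsf{A}_{\ell-1}$ (so it is isomorphic to $\mathrm{E}(\mathsf{A}_{\ell-1},R,I)$). A row $(a_1,\ldots,a_n)\in R^n$ is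 $I$-unimodular if it is congruent to $(1,0,\ldots,0)$ modulo $I$ and its components generate $R$ as an ideal. $\mathrm{SR}_n(I)$: for every $I$-unimodular row $(a_1,\ldots,a_{n+1})$ there are $b_1,\ldots,b_n\in I$ such that $(a_1+a_{n+1}b_1,\ldots,a_n+a_{n+1}b_n)$ is $I$-unimodular. $\mathrm{sr}(I)$ is the smallest natural $n\geqslant 1$ with $\mathrm{SR}_n(I)$ ($\infty$ if none). *)

(* Defs.v *)
From HB Require Import structures.
From mathcomp Require Import all_boot all_order all_algebra.
From mathcomp Require Import boolp classical_sets.

Set Implicit Arguments.
Unset Strict Implicit.
Unset Printing Implicit Defensive.

Import Order.TTheory GRing.Theory Num.Theory.

Local Open Scope classical_set_scope.
Local Open Scope ring_scope.

(* The group of two-sided invertible elements of a ring (possibly zero,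
   possibly noncommutative, without decidable invertibility), an element being
   stored together with its inverse.                                          *)
Section UnitGroup.
Variable A : pzRingType.

Record units := Units {
  unit_pair : A * A;
  _ : (unit_pair.1 * unit_pair.2 == 1) && (unit_pair.2 * unit_pair.1 == 1) }.

HB.instance Definition _ := [isSub for unit_pair].
HB.instance Definition _ := [Choice of units by <:].

Definition unit_val (u : units) : A := (unit_pair u).1.

Definition mk_unit (a b : A) (ab : a * b = 1) (ba : b * a = 1) : units :=
  @Units (a, b) (introT andP (conj (introT eqP ab) (introT eqP ba))).

Lemma unit_valV (u : units) : unit_val u * (unit_pair u).2 = 1.
Proof. by case: u => -[a b] i; case/andP: (i) => /eqP. Qed.

Lemma unit_Vval (u : units) : (unit_pair u).2 * unit_val u = 1.
Proof. by case: u => -[a b] i; case/andP: (i) => _ /eqP. Qed.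

Lemma unit_val_inj : injective unit_val.
Proof.
move=> u v uv; apply: val_inj.
have uv2 : (unit_pair u).2 = (unit_pair v).2.
  by rewrite -[LHS]mulr1 -(unit_valV v) mulrA -uv unit_Vval mul1r.
by move: uv uv2; rewrite /unit_val /=; case: (unit_pair u) (unit_pair v) =>
  [? ?] [? ?] /= -> ->.
Qed.

Fact units_mul_subproof (u v : units) :
  (unit_val u * unit_val v) * ((unit_pair v).2 * (unit_pair u).2) = 1 /\
  ((unit_pair v).2 * (unit_pair u).2) * (unit_val u * unit_val v) = 1.
Proof.
split.
  by rewrite mulrA -(mulrA (unit_val u)) unit_valV mulr1 unit_valV.
by rewrite mulrA -(mulrA (unit_pair v).2) unit_Vval mulr1 unit_Vval.
Qed.

Definition units_one : units := mk_unit (mulr1 1) (mulr1 1).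
Definition units_mul (u v : units) : units :=
  mk_unit (proj1 (units_mul_subproof u v)) (proj2 (units_mul_subproof u v)).
Definition units_inv (u : units) : units := mk_unit (unit_Vval u) (unit_valV u).

Fact units_mulA : associative units_mul.
Proof. by move=> u v w; apply: unit_val_inj; rewrite /unit_val /= mulrA. Qed.
Fact units_mul1 : left_id units_one units_mul.
Proof. by move=> u; apply: unit_val_inj; rewrite /unit_val /= mul1r. Qed.
Fact units_1mul : right_id units_one units_mul.
Proof. by move=> u; apply: unit_val_inj; rewrite /unit_val /= mulr1. Qed.
Fact units_mulV : left_inverse units_one units_inv units_mul.
Proof. by move=> u; apply: unit_val_inj; exact: unit_Vval. Qed.
Fact units_Vmul : right_inverse units_one units_inv units_mul.
Proof. by move=> u; apply: unit_val_inj; exact: unit_valV. Qed.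

HB.instance Definition _ := isGroup.Build units
  units_mulA units_mul1 units_1mul units_mulV units_Vmul.

End UnitGroup.

Section Subgroups.
Local Open Scope group_scope.
Variable G : groupType.

Definition is_subgroup (H : set G) :=
  [/\ H 1, forall x y, H x -> H y -> H (x * y) & forall x, H x -> H x^-1].

Definition generated (S : set G) : set G := smallest is_subgroup S.

Definition is_normal_in (K N : set G) :=
  [/\ is_subgroup N, N `<=` K & forall g x, K g -> N x -> N (g * x * g^-1)].

Definition normal_closure (K S : set G) : set G := smallest (is_normal_in K) S.

Definition mulg_set (A B : set G) : set G := [set x * y | x in A & y in B].

Definition conjg_set (g : G) (A : set G) : set G := [set g * x * g^-1 | x in A].

End Subgroups.

Section StableRank.
Variable R : comPzRingType.

Definition is_ideal (I : set R) :=
  [/\ I 0, forall x y, I x -> I y -> I (x + y) & forall r x, I x -> I (r * x)].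

(* The components are numbered from 0. *)
Definition unimodular_row (I : set R) (n : nat) (a : 'rV[R]_n) :=
  (forall i : 'I_n, I (a 0 i - (i == 0 :> nat)%:R)) /\
  (exists c : 'I_n -> R, \sum_(i < n) c i * a 0 i = 1).

Definition SR (n : nat) (I : set R) :=
  forall (a : 'rV[R]_n) (z : R), unimodular_row I (row_mx a z%:M) ->
  exists2 b : 'rV[R]_n, forall i, I (b 0 i) & unimodular_row I (a + z *: b).

Definition is_sr (I : set R) (n : nat) :=
  [/\ (1 <= n)%N, SR n I & forall k, (1 <= k < n)%N -> ~ SR k I].

(* sr(I) <= n; in particular sr(I) is finite. *)
Definition sr_le (I : set R) (n : nat) := exists2 k, is_sr I k & (k <= n)%N.

End StableRank.

Section RootSystem.
Variable l : nat.

(* (i, false) stands for the weight eps_i of the natural representation, and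
   (i, true) for the weight - eps_i.                                          *)
Definition sidx := ('I_l * bool)%type.

Definition opp_sidx (p : sidx) : sidx := (p.1, ~~ p.2).

Definition eps (p : sidx) : 'rV[rat]_l := (-1) ^+ p.2 *: delta_mx 0 p.1.

(* The roots (+/-) eps_i (+/-) eps_j of D_l, listed once each thanks to i < j. *)
Definition Droot := {r : sidx * sidx | (r.1.1 < r.2.1)%N}.

Definition root_vec (r : Droot) : 'rV[rat]_l := eps (val r).1 + eps (val r).2.

Definition dotv (u v : 'rV[rat]_l) : rat := (u *m v^T) 0 0.

Definition cartan (u v : 'rV[rat]_l) : rat := 2 * dotv u v / dotv v v.

Definition is_root_subsystem (D : {set Droot}) :=
  forall a b, a \in D -> b \in D ->
  exists2 c, c \in D &
    root_vec c = root_vec a - cartan (root_vec a) (root_vec b) *: root_vec b.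

(* The standard root system of type A_{l-1}, spanning a hyperplane of Q^l. *)
Definition stdA : set 'rV[rat]_l :=
  [set v | exists i j : 'I_l, i != j /\ v = delta_mx 0 i - delta_mx 0 j].

(* D is isomorphic, as a root system, to A_{l-1}. An isomorphism is a linear
   bijection between the spans carrying roots onto roots and preserving Cartan
   integers; as both spans lie in Q^l, it is the restriction of some
   automorphism of Q^l.                                                       *)
Definition is_typeA (D : {set Droot}) :=
  exists M : 'M[rat]_l,
  [/\ M \in unitmx,
      [set v *m M | v in stdA] = [set root_vec r | r in [set` D]] &
      forall u v, stdA u -> stdA v -> cartan (u *m M) (v *m M) = cartan u v].

End RootSystem.

(* The spinor module over R is free on the subsets of {0, ..., l-1}: it is the
   exterior algebra of R^l, the subset {i1 < ... < ik} standing for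
   e_i1 /\ ... /\ e_ik, of weight 1/2 (+/- eps_0 ... +/- eps_{l-1}) with sign +
   exactly at the members of the subset. The Clifford algebra of the hyperbolic
   quadratic space of rank 2l is its full endomorphism ring.                  *)
Section Spin.
Variables (R : comPzRingType) (l : nat).

Notation spin_dim := #|{: {set 'I_l}}|.
Notation spin_mx := 'M[R]_spin_dim.

Definition flip (p : sidx l) (B : {set 'I_l}) : {set 'I_l} :=
  if p.2 then (B :\ p.1)%SET else (p.1 |: B)%SET.

Definition sgn (i : 'I_l) (B : {set 'I_l}) : R :=
  (-1) ^+ #|[set j in B | (j < i)%N]%SET|.

(* Clifford multiplication by the basis vector of weight eps p, acting on
   columns: e_i /\ - for (i, false), the contraction by the i-th coordinate form
   for (i, true).                                                             *)
Definition gamma (p : sidx l) : spin_mx :=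
  \matrix_(a < spin_dim, b < spin_dim)
    let A := enum_val a in let B := enum_val b in
    if ((p.1 \in B) == p.2) && (A == flip p B) then sgn p.1 B else 0.

Lemma gamma_mul p q a c :
  (gamma p *m gamma q) a c =
  let A := enum_val a in let C := enum_val c in
  if [&& (q.1 \in C) == q.2, (p.1 \in flip q C) == p.2 &
         A == flip p (flip q C)]
  then sgn p.1 (flip q C) * sgn q.1 C else 0.
Proof.
rewrite mxE (bigD1 (enum_rank (flip q (enum_val c)))) //= big1; last first.
  move=> b bNc; rewrite !mxE /=.
  rewrite [in X in _ * X](_ : enum_val b == _ = false) ?andbF ?mulr0 //.
  by apply: contraNF bNc => /eqP <-; rewrite enum_valK.
rewrite addr0 !mxE /= !enum_rankK eqxx andbT.
by case: (_ == q.2); rewrite ?mulr0 //=; case: ifP => _; rewrite ?mul0r.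
Qed.

Lemma mem_flip p (C : {set 'I_l}) i :
  (i \in flip p C) = if i == p.1 then ~~ p.2 else i \in C.
Proof.
rewrite /flip; case: p.2; rewrite !inE; first by case: (i == p.1).
by case: (i == p.1).
Qed.

Lemma sgn_flip (p : sidx l) (C : {set 'I_l}) i : (p.1 \in C) == p.2 ->
  sgn i (flip p C) = (-1) ^+ (p.1 < i)%N * sgn i C.
Proof.
move=> ok; rewrite /sgn.
have cardE (D : {set 'I_l}) : #|[set j in D | (j < i)%N]%SET| =
    ((p.1 \in D) && (p.1 < i)%N +
     #|[set j in D | (j != p.1) && (j < i)%N]%SET|)%N.
  rewrite (cardsD1 p.1) inE; congr (_ + _)%N; apply: eq_card => j.
  by rewrite !inE andbCA.
rewrite !cardE mem_flip eqxx (eqP ok).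
have -> : [set j in flip p C | (j != p.1) && (j < i)%N]%SET =
          [set j in C | (j != p.1) && (j < i)%N]%SET.
  by apply/setP => j; rewrite !inE mem_flip; case: (j == p.1); rewrite ?andbF.
rewrite !exprD mulrA; congr (_ * _); rewrite -exprD.
by case: p.2; case: (p.1 < i)%N; rewrite //= ?expr0 ?expr1 ?sqrrN ?expr1n.
Qed.

Lemma gamma_sqr p : gamma p *m gamma p = 0.
Proof.
apply/matrixP => a c; rewrite gamma_mul mxE /= mem_flip eqxx.
by rewrite (_ : ~~ p.2 == p.2 = false) ?andbF //; case: p.2.
Qed.

Lemma clifford_relation p q :
  gamma p *m gamma q + gamma q *m gamma p = (q == opp_sidx p)%:R%:M.
Proof.
apply/matrixP => a c; rewrite [LHS]mxE !gamma_mul mxE /= !mem_flip.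
rewrite -(inj_eq enum_val_inj).
set A := enum_val a; set C := enum_val c.
have [pq|pNq] := eqVneq p.1 q.1; last first.
  have -> : (q == opp_sidx p) = false.
    by apply: contraNF pNq => /eqP ->; rewrite eqxx.
  rewrite mul0rn.
  have -> : flip p (flip q C) = flip q (flip p C).
    apply/setP => j; rewrite !mem_flip.
    by case: (eqVneq j p.1) => [->|//]; rewrite (negPf pNq).
  case okq: (_ == q.2); case okp: (_ == p.2) => /=; rewrite ?addr0 //.
  case: ifP => _; rewrite ?addr0 // !sgn_flip //.
  have := pNq; rewrite -val_eqE /= neq_ltn => /orP[] lt;
    rewrite lt (ltnNge _ _) (ltnW lt) /= expr0 expr1 !mul1r mulN1r mulNr.
    by rewrite mulrC subrr.
  by rewrite mulrC addNr.
rewrite -?pq ?eqxx.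
have fK (r : sidx l) : ((r.1 \in C) == r.2) -> flip (opp_sidx r) (flip r C) = C.
  move=> /eqP ok; apply/setP => j; rewrite !mem_flip /= negbK.
  by case: eqP => // ->.
have sgK (r : sidx l) : ((r.1 \in C) == r.2) ->
    sgn r.1 (flip r C) * sgn r.1 C = 1.
  move=> ok; rewrite sgn_flip // ltnn mul1r /sgn -exprD -signr_odd.
  by rewrite oddD addbb.
have [Eq|qN] := eqVneq q (opp_sidx p).
  have Ep : p = opp_sidx q by rewrite Eq /opp_sidx /= negbK -surjective_pairing.
  have q2 : q.2 = ~~ p.2 by rewrite Eq.
  rewrite q2 negbK !eqxx /=.
  case ok: ((p.1 \in C) == p.2).
    have -> : ((p.1 \in C) == ~~ p.2) = false by rewrite (eqP ok); case: (p.2).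
    by rewrite Eq fK // sgK // add0r; case: eqP.
  have ok' : (q.1 \in C) == q.2.
    by rewrite -pq q2; move: ok; case: (_ \in _) (p.2) => [] [].
  have := ok'; rewrite -pq q2 => -> /=.
  rewrite {1}Ep fK // {2}pq. rewrite [in sgn p.1 _]pq.
  by rewrite sgK // addr0; case: eqP.
have -> : q = p.
  case: (p) (q) pq qN => [i s] [j t] /= <-.
  by rewrite /opp_sidx /= xpair_eqE eqxx /=; case: s t => [] [].
by rewrite (_ : ~~ p.2 == p.2 = false) ?andbF ?addr0 ?mul0rn //; case: p.2.
Qed.

(* Up to sign, the root vector of the weight root_vec r in the Chevalley basis of
   the Lie algebra of type D_l, acting on the spinor module; its square is zero. *)
Definition root_op (r : Droot l) : spin_mx := gamma (val r).1 *m gamma (val r).2.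

Lemma root_op_sqr r : root_op r *m root_op r = 0.
Proof.
case: r => -[p q] /= ltpq; rewrite /root_op /=.
have qNp : (q == opp_sidx p) = false.
  by apply/eqP => E; move: ltpq; rewrite E ltnn.
have /eqP := clifford_relation p q; rewrite qNp raddf0 addr_eq0 => /eqP E.
rewrite {1}E mulNmx -mulmxA [X in _ *m X]mulmxA gamma_sqr mul0mx mulmx0.
by rewrite oppr0.
Qed.

Fact root_elt_subproof r (xi : R) :
  (1 + xi *: root_op r : spin_mx) * (1 + (- xi) *: root_op r) = 1.
Proof.
rewrite mulrDl mul1r mulrDr mulr1 addrA -mulmxE -scalemxAl -scalemxAr.
by rewrite root_op_sqr !scaler0 addr0 -addrA -scalerDl addNr scale0r addr0.
Qed.

Fact root_elt_subproofV r (xi : R) :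
  (1 + (- xi) *: root_op r : spin_mx) * (1 + xi *: root_op r) = 1.
Proof. by rewrite -{2}[xi]opprK root_elt_subproof. Qed.

(* The ambient group. The weights of the spinor module generate the whole weight
   lattice of D_l, hence the exponentials of the root vectors acting on it
   generate the elementary subgroup of the simply connected group Spin(2l, R). *)
Definition spinGL := units spin_mx.

(* x_alpha(xi) = exp(xi e_alpha), the exponential series stopping after the linear
   term by root_op_sqr.                                                         *)
Definition root_elt (r : Droot l) (xi : R) : spinGL :=
  mk_unit (root_elt_subproof r xi) (root_elt_subproofV r xi).

Definition E_abs (D : {set Droot l}) : set spinGL :=
  generated [set g | exists r xi, r \in D /\ g = root_elt r xi].

Definition E_rel (D : {set Droot l}) (I : set R) : set spinGL :=
  normal_closure (E_abs D)
    (generated [set g | exists r s, [/\ r \in D, I s & g = root_elt r s]]).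

Definition Epin : set spinGL := E_abs [set: Droot l]%SET.

Definition Epin_rel (I : set R) : set spinGL := E_rel [set: Droot l]%SET I.

Definition regularly_embedded_A (I : set R) (H : set spinGL) :=
  exists (g : spinGL) (D : {set Droot l}),
  [/\ Epin g, is_root_subsystem D, is_typeA D & H = conjg_set g (E_rel D I)].

End Spin.

Arguments Epin R l : clear implicits.
Arguments Epin_rel {R} l I.

(* Main.v *)
Require Import Defs.
From mathcomp Require Import all_boot all_order all_algebra.
From mathcomp Require Import perm boolp classical_sets ring zify.

(** Let T(x, y) = 1 + x y be the transvection of two orthogonal isotropic vectors.
    A choice b of signs gives a maximal isotropic subspace with basis e_i, an
    opposite one with basis f_i, a subsystem of type A_{l-1} whose elementary
    group [levi b] acts linearly on both, and the radicals [radical b] and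
    [radical (negb_fun b)] generated by the T(e_i, e_j) and by the T(f_i, f_j).
    Let c differ from b at one index n, so that b and c give the two classes of
    Siegel parabolic subgroups. Let P and Q be the products of the relative Levi
    subgroup and the radical over I for c and for b, and let S be the
    intersection over I of the two opposite radicals.

    First, P S Q contains Epin(2l, R, I) ([Epin_rel_big_cell]); this is where the
    stable rank enters. The set P S Q is stable under right multiplication by the
    opposite radical of b ([big_cell_transv], [big_cell_right_radical]): moving a
    factor T(f_j, t f_n) to the left of the Levi component h of Q turns f_j and f_n
    into two columns of a matrix congruent to 1 modulo I. By [plane_reduction],
    SR 2 makes the pair of their n-th coordinates unimodular, a base change in
    the plane they span turns this pair into (0, 1), and the transvection
    becomes conjugate to an element of the Levi subgroup of c. It follows that
    [levi b] normalises P S Q ([big_cell_conj_levi]). The inverse set Q S P has the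
    same shape, so [levi c] normalises P S Q too; together they generate
    Epin(2l, R). Hence P S Q contains the normal closure of the root unipotents
    over I.

    Second, every radical over I is covered by two regularly embedded subgroups
    ([radical_sub_two]). Changing the signs of b at the odd indices gives a
    subsystem of type A_{l-1} containing all e_i + e_j with i even and j odd. In
    terms of bivectors, the products of an even and an odd vector, together with
    their images under a suitable unipotent matrix, span all bivectors.

    P and Q thus need three factors each, one for the Levi subgroup and two for the
    radical, and S needs two. The product of these eight subgroups contains
    Epin(2l, R, I), hence is equal to it. *)

Set Implicit Arguments.
Unset Strict Implicit.
Unset Printing Implicit Defensive.

Import GRing.Theory.
Local Open Scope classical_set_scope.
Local Open Scope ring_scope.

(** * Subgroups, normal closures and products of subsets *)

Section SubgroupTheory.
Local Open Scope group_scope.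
Variable G : groupType.
Implicit Types (A B C H K N S : set G) (g x y : G).

Lemma generated_subgroup S : is_subgroup (generated S).
Proof.
split=> [N [[N1 _ _] _] //|x y Sx Sy N NS|x Sx N NS]; case: (NS) => -[_ NM NV] _.
  by apply: NM; [apply: Sx | apply: Sy].
by apply: NV; apply: Sx.
Qed.

Lemma mem_generated S x : S x -> generated S x.
Proof. by move=> Sx N [_]; apply. Qed.

Lemma generated_min S H : is_subgroup H -> S `<=` H -> generated S `<=` H.
Proof. by move=> sgH SH x; apply. Qed.

Lemma generatedS S T : S `<=` T -> generated S `<=` generated T.
Proof.
by move=> ST; apply: generated_min (generated_subgroup T) _ => x /ST/mem_generated.
Qed.

Lemma subgroup_conj H g : is_subgroup H -> is_subgroup [set x | H (g * x * g^-1)].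
Proof.
case=> H1 HM HV; split=> /=; first by rewrite mulg1 mulgV.
  move=> x y Hx Hy.
  have -> : g * (x * y) * g^-1 = (g * x * g^-1) * (g * y * g^-1).
    by rewrite !mulgA mulgVK.
  exact: HM.
move=> x /HV; rewrite !invgM invgK mulgA; exact.
Qed.

Lemma generated_conj S T g :
  (forall x, S x -> generated T (g * x * g^-1)) ->
  forall x, generated S x -> generated T (g * x * g^-1).
Proof.
move=> ST; apply: generated_min ST; apply: subgroup_conj.
exact: generated_subgroup.
Qed.

Lemma subgroup_conjV H g : is_subgroup H -> H g -> forall x, H x -> H (g * x * g^-1).
Proof. by case=> _ HM HV Hg x Hx; apply: (HM); [apply: HM | apply: HV]. Qed.

Lemma subgroupI H K : is_subgroup H -> is_subgroup K -> is_subgroup (H `&` K).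
Proof.
case=> H1 HM HV [K1 KM KV]; split=> [|x y [Hx Kx] [Hy Ky]|x [Hx Kx]]; split;
  by [|apply: HM|apply: KM|apply: HV|apply: KV].
Qed.

Lemma normal_closure_normal K S :
  is_subgroup K -> S `<=` K -> is_normal_in K (normal_closure K S).
Proof.
move=> sgK SK; have [K1 KM KV] := sgK.
have nKK : is_normal_in K K by split=> // g x Kg; apply: subgroup_conjV.
split; [split|by move=> x; apply|].
- by move=> N [[[]]].
- move=> x y Nx Ny N NS; case: (NS) => -[[_ NM _] _ _] _.
  by apply: NM; [apply: Nx | apply: Ny].
- move=> x Nx N NS; case: (NS) => -[[_ _ NV] _ _] _.
  by apply: NV; apply: Nx.
move=> g x Kg Nx N NS; case: (NS) => -[_ _ NJ] _.
by apply: NJ => //; apply: Nx.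
Qed.

Lemma mem_normal_closure K S x : S x -> normal_closure K S x.
Proof. by move=> Sx N [_]; apply. Qed.

Lemma normal_closure_min K S N :
  is_normal_in K N -> S `<=` N -> normal_closure K S `<=` N.
Proof. by move=> nN SN x; apply. Qed.

Lemma mulg_setP A B x : mulg_set A B x <-> exists y z, [/\ A y, B z & x = y * z].
Proof.
split=> [[y Ay [z Bz <-]]|[y [z [Ay Bz ->]]]]; first by exists y, z.
by exists y => //; exists z.
Qed.

Lemma mem_mulg_set A B x y : A x -> B y -> mulg_set A B (x * y).
Proof. by move=> Ax By; exists x => //; exists y. Qed.

Lemma mulg_setA A B C : mulg_set A (mulg_set B C) = mulg_set (mulg_set A B) C.
Proof.
apply/seteqP; split=> x /mulg_setP[y [z [+ + ->]]].
  move=> Ay /mulg_setP[b [c [Bb Cc ->]]]; rewrite mulgA.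
  by apply: mem_mulg_set => //; apply: mem_mulg_set.
move=> /mulg_setP[b [c [Bb Cc ->]]] Cz; rewrite -mulgA.
by apply: mem_mulg_set => //; apply: mem_mulg_set.
Qed.

Lemma mulg_setS A B C D :
  A `<=` B -> C `<=` D -> mulg_set A C `<=` mulg_set B D.
Proof.
by move=> AB CD _ [a /AB Ba [c /CD Dc <-]]; apply: mem_mulg_set.
Qed.

Lemma mulg_set_subgroup H K : is_subgroup H -> is_subgroup K ->
  (forall x y, H x -> K y -> x * y = y * x) -> is_subgroup (mulg_set H K).
Proof.
move=> [H1 HM HV] [K1 KM KV] HK; split.
- by rewrite -[1]mulg1; apply: mem_mulg_set.
- move=> _ _ [a Ha [b Kb <-]] [c Hc [d Kd <-]].
  have -> : (a * b) * (c * d) = (a * c) * (b * d).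
    by rewrite -!mulgA; congr (a * _); rewrite !mulgA (HK c b).
  by apply: mem_mulg_set; [apply: HM | apply: KM].
- move=> _ [a Ha [b Kb <-]]; rewrite invgM -HK; [|exact: HV|exact: KV].
  by apply: mem_mulg_set; [apply: HV | apply: KV].
Qed.

Lemma generated_abelian S : (forall x y, S x -> S y -> x * y = y * x) ->
  forall x y, generated S x -> generated S y -> x * y = y * x.
Proof.
move=> SS.
have cent (T : set G) : is_subgroup [set x | forall y, T y -> x * y = y * x].
  split=> /= [y _|x z Tx Tz y Ty|x Tx y Ty]; first by rewrite mul1g mulg1.
    by rewrite -mulgA Tz // !mulgA Tx.
  by apply: (mulgI x); rewrite !mulgA mulgV mul1g Tx // mulgK.
have gS x : generated S x -> forall y, S y -> x * y = y * x.
  apply: (generated_min (cent S)) => z Sz y; exact: SS.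
move=> x y gx; move: x gx y; apply: (generated_min (cent _)) => z Sz y gy.
by rewrite (gS y gy z Sz).
Qed.

Lemma mulg_set_sub H A B : is_subgroup H ->
  A `<=` H -> B `<=` H -> mulg_set A B `<=` H.
Proof. by move=> [_ HM _] AH BH _ [x /AH Hx [y /BH Hy <-]]; apply: HM. Qed.

Lemma mulg_set1 A : mulg_set A [set 1] = A.
Proof.
apply/seteqP; split=> [_ [x Ax [_ -> <-]]|x Ax]; first by rewrite mulg1.
by rewrite -[x]mulg1; apply: mem_mulg_set.
Qed.

End SubgroupTheory.

Section SetStabilisers.
Local Open Scope group_scope.
Variables (G : groupType) (Y : set G).

Definition right_stabiliser : set G :=
  [set x | forall y, Y y -> Y (y * x) /\ Y (y * x^-1)].

Definition conj_stabiliser : set G :=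
  [set x | forall y, Y y -> Y (x * y * x^-1) /\ Y (x^-1 * y * x)].

Lemma right_stabiliser_subgroup : is_subgroup right_stabiliser.
Proof.
split=> [y Yy|x z Sx Sz y Yy|x Sx y Yy].
- by rewrite invg1 mulg1.
- rewrite invgM !mulgA; split.
    by have [/Sz[]] := Sx y Yy.
  by have [_ /Sx[]] := Sz y Yy.
- by rewrite invgK; have [] := Sx y Yy.
Qed.

Lemma conj_stabiliser_subgroup : is_subgroup conj_stabiliser.
Proof.
split=> [y Yy|x z Sx Sz y Yy|x Sx y Yy].
- by rewrite invg1 mulg1 mul1g.
- have -> : x * z * y * (x * z)^-1 = x * (z * y * z^-1) * x^-1.
    by rewrite invgM !mulgA.
  have -> : (x * z)^-1 * y * (x * z) = z^-1 * (x^-1 * y * x) * z.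
    by rewrite invgM !mulgA.
  split; first by have [/Sx[]] := Sz y Yy.
  by have [_ /Sz[]] := Sx y Yy.
- by rewrite invgK; have [] := Sx y Yy.
Qed.

(** Since y (g x g^-1) = g ((g^-1 y g) x) g^-1, the elements of K stabilising Y on the
    right form a normal subgroup of K as soon as K normalises Y, although Y need
    not be a subgroup. *)
Lemma normal_closure_stabiliser (K S : set G) : is_subgroup K -> Y 1 ->
  K `<=` conj_stabiliser -> S `<=` K -> S `<=` right_stabiliser ->
  normal_closure K S `<=` Y.
Proof.
move=> sgK Y1 KY SK SY x Sx.
suff [_ xY] : (K `&` right_stabiliser) x.
  by have [+ _] := xY 1 Y1; rewrite mul1g.
move: x Sx; apply: normal_closure_min; last by move=> x Sx; split; [exact: SK|exact: SY].
split; first exact: subgroupI sgK right_stabiliser_subgroup.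
  by move=> x [].
move=> g x Kg [Kx xY]; split; first exact: (subgroup_conjV sgK Kg Kx).
move=> y Yy; have [_ /xY[Y1' Y2']] := KY g Kg y Yy.
have [+ _] := KY g Kg _ Y1'; have [+ _] := KY g Kg _ Y2'.
rewrite !invgM !invgK !mulgA !mulgV !mul1g; split; assumption.
Qed.

End SetStabilisers.

Lemma conj_stabiliserV (G0 : groupType) (Y Z : set G0) :
  (forall y, Y y <-> Z y^-1%g) -> conj_stabiliser Y `<=` conj_stabiliser Z.
Proof.
move=> YZ g gY z Zz.
have YZV y : Y y^-1%g <-> Z y by rewrite YZ invgK.
have [/YZ + /YZ] := gY z^-1%g (proj2 (YZV z) Zz).
by rewrite !invgM !invgK !mulgA.
Qed.

(** * Transvections of a Clifford module *)

Section Transvections.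
Variables (R : comPzRingType) (n : nat).
Local Notation A := 'M[R]_n.
Implicit Types (x y z : A) (g : units A) (a c : R).

Lemma unit_valM g h : unit_val (g * h)%g = unit_val g * unit_val h.
Proof. by []. Qed.

Definition act g x : A := unit_val g * x * unit_val g^-1%g.

Lemma act1 x : act 1%g x = x.
Proof. by rewrite /act /unit_val /= mul1r mulr1. Qed.

Lemma actM g h x : act (g * h)%g x = act g (act h x).
Proof. by rewrite /act invgM /unit_val /= !mulrA. Qed.

Lemma actZ g c x : act g (c *: x) = c *: act g x.
Proof. by rewrite /act -!mulmxE -scalemxAr -scalemxAl. Qed.

Lemma actN g x : act g (- x) = - act g x.
Proof. by rewrite -!scaleN1r actZ. Qed.

Lemma act_mul g x y : act g (x * y) = act g x * act g y.
Proof.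
rewrite /act -!mulrA; congr (_ * (x * _)).
by rewrite (mulrA (unit_val g^-1%g)) unit_Vval mul1r.
Qed.

(** In a Clifford algebra, x x is the value of the quadratic form at the vector x
    and x y + y x that of its polar form at x and y. *)
Definition isotropic x y := [/\ x * x = 0, y * y = 0 & x * y = - (y * x)].

(** The spinorial Eichler-Siegel-Dickson transvection, the exponential of the
    bivector of x and y. *)
Definition transv : A -> A -> units A :=
  locked (fun x y => insubd (1%g : units A) (1 + x * y, 1 - x * y)).

Lemma unit_pair_transv x y :
  isotropic x y -> unit_pair (transv x y) = (1 + x * y, 1 - x * y).
Proof.
case=> xx yy xy; have sq : x * y * (x * y) = 0.
  by rewrite {2}xy mulrN mulrA -(mulrA x) yy mulr0 mul0r oppr0.
rewrite /transv -lock; apply: insubdK; rewrite /in_mem /=; apply/andP; split; apply/eqP.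
  by rewrite mulrDl mul1r mulrBr mulr1 sq subr0 subrK.
by rewrite mulrBl mul1r mulrDr mulr1 sq addr0 addrK.
Qed.

Lemma unit_transv x y : isotropic x y -> unit_val (transv x y) = 1 + x * y.
Proof. by move=> xy; rewrite /unit_val unit_pair_transv. Qed.

Lemma transv_act g x y : isotropic x y ->
  (g * transv x y * g^-1)%g = transv (act g x) (act g y).
Proof.
move=> xy; have [xx yy xyN] := xy.
have gxy : isotropic (act g x) (act g y).
  split; rewrite -!act_mul ?xx ?yy ?xyN ?actN //.
    by rewrite /act mulr0 mul0r.
  by rewrite /act mulr0 mul0r.
apply: unit_val_inj; rewrite unit_transv // -act_mul.
by rewrite !unit_valM unit_transv // mulrDr mulrDl mulr1 unit_valV.
Qed.

Lemma isotropic_sym x y : isotropic x y -> isotropic y x.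
Proof. by case=> xx yy xy; split=> //; rewrite xy opprK. Qed.

Lemma isotropicZ c x y : isotropic x y -> isotropic x (c *: y).
Proof.
case=> xx yy xy; split=> //; rewrite -!mulmxE -!scalemxAl -!scalemxAr mulmxE.
  by rewrite yy !scaler0.
by rewrite xy scalerN.
Qed.

Lemma isotropic0 x : x * x = 0 -> isotropic x 0.
Proof. by move=> xx; split; rewrite ?mulr0 ?mul0r ?oppr0. Qed.

Lemma transvx0 x : x * x = 0 -> transv x 0 = 1%g.
Proof.
move=> /isotropic0 x0; apply: unit_val_inj.
by rewrite unit_transv // mulr0 addr0.
Qed.

Lemma transvxx x c : x * x = 0 -> transv x (c *: x) = 1%g.
Proof.
move=> xx; apply: unit_val_inj; rewrite unit_transv; last first.
  by apply: isotropicZ; split=> //; rewrite xx oppr0.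
by rewrite -mulmxE -scalemxAr mulmxE xx scaler0 addr0.
Qed.

Lemma transvDr x y z : isotropic x y -> isotropic x z -> isotropic y z ->
  transv x (y + z) = (transv x y * transv x z)%g.
Proof.
move=> xy xz yz; case: (xy) (xz) (yz) => xx yy xyN [_ zz xzN] [_ _ yzN].
apply: unit_val_inj; rewrite unit_valM !unit_transv //; last first.
  split=> //; last by rewrite mulrDl mulrDr xyN xzN opprD.
  by rewrite mulrDl !mulrDr yy zz yzN add0r addr0 addNr.
have -> : (1 + x * y) * (1 + x * z) = 1 + x * z + x * y + x * y * (x * z).
  by rewrite mulrDl mul1r mulrDr mulr1 addrA.
rewrite {2}xyN mulNr -(mulrA y x) (mulrA x x) xx mul0r mulr0 oppr0 addr0.
by rewrite mulrDr -!addrA [x * y + _]addrC.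
Qed.

Lemma transv_swap x y c : isotropic x y -> transv x (c *: y) = transv y (- c *: x).
Proof.
move=> xy; have yx := isotropic_sym xy; apply: unit_val_inj.
rewrite !unit_transv; [|exact: isotropicZ|exact: isotropicZ].
by case: xy => _ _ xy; rewrite -!mulmxE -!scalemxAr mulmxE xy scaleNr scalerN.
Qed.

Lemma transvDl x y z : isotropic x y -> isotropic x z -> isotropic y z ->
  transv (x + y) z = (transv x z * transv y z)%g.
Proof.
move=> xy xz yz; case: (xy) (xz) (yz) => xx yy xyN [_ zz xzN] [_ _ yzN].
apply: unit_val_inj; rewrite unit_valM !unit_transv //; last first.
  split=> //; last by rewrite mulrDl mulrDr xzN yzN opprD.
  by rewrite mulrDl !mulrDr xx yy xyN add0r addr0 addNr.
have -> : (1 + x * z) * (1 + y * z) = 1 + y * z + x * z + x * z * (y * z).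
  by rewrite mulrDl mul1r mulrDr mulr1 addrA.
rewrite {2}yzN mulrN (mulrA _ z y) -(mulrA x z z) zz mulr0 mul0r oppr0 addr0.
by rewrite mulrDl -!addrA [y * z + _]addrC.
Qed.

Lemma transvV x y : isotropic x y -> (transv x y)^-1%g = transv x (- y).
Proof.
move=> xy; apply: unit_val_inj.
rewrite -[LHS]/((unit_pair (transv x y)).2) unit_pair_transv // unit_transv ?mulrN //.
by rewrite -scaleN1r; apply: isotropicZ.
Qed.

(** Moving z to the left of x y by the Clifford relations leaves the two linear
    terms; the term x y z x y vanishes, for x x = y x y = 0. *)
Lemma act_transv x y z a c : isotropic x y ->
  x * z + z * x = a%:M -> y * z + z * y = c%:M ->
  act (transv x y) z = z + c *: x - a *: y.
Proof.
move=> xy xz yz; rewrite /act unit_transv // /unit_val /= unit_pair_transv //=.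
case: (xy) => xx yy xyN.
have yxy : y * x * y = 0.
  by rewrite -[y * x]opprK -xyN mulNr -mulrA yy mulr0 oppr0.
have xyz : x * y * z = c *: x - a *: y + z * (x * y).
  have yzE : y * z = c%:M - z * y by rewrite -yz addrK.
  have xzE : x * z = a%:M - z * x by rewrite -xz addrK.
  rewrite -mulrA yzE mulrBr (mulrA x z y) xzE mulrBl -mulmxE.
  by rewrite mul_mx_scalar mul_scalar_mx mulmxE opprB addrA addrAC -mulrA.
have z4 : x * y * z * (x * y) = 0.
  rewrite xyz mulrDl mulrBl -(mulrA z) (mulrA (x * y)) -(mulrA x y x).
  rewrite -(mulrA x (y * x)) yxy mulr0 mulr0 addr0.
  by rewrite -mulmxE -!scalemxAl !mulmxE !mulrA xx yxy mul0r !scaler0 subrr.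
rewrite mulrDl mul1r mulrBr mulr1 mulrDl z4 addr0 xyz.
by rewrite -!addrA; congr (_ + _); rewrite !addrA addrK.
Qed.

End Transvections.

(** * Maximal isotropic subspaces of the Clifford module *)

Section Lagrangians.
Variables (R : comPzRingType) (l : nat).
Local Notation A := 'M[R]_#|{: {set 'I_l}}|.
Local Notation G := (spinGL R l).
Implicit Types (b : 'I_l -> bool) (u v : 'cV[R]_l) (I J : set R) (i j k : 'I_l).

Definition negb_fun b i := ~~ b i.

(** The vectors [evec b u] fill a maximal isotropic subspace, and those of the
    opposite choice of signs a complementary one. *)
Definition evec b u : A := \sum_i u i 0 *: gamma R (i, b i).

Definition basis i : 'cV[R]_l := delta_mx i 0.

Lemma evecD b u v : evec b (u + v) = evec b u + evec b v.
Proof. by rewrite -big_split; apply: eq_bigr => i _; rewrite mxE scalerDl. Qed.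

Lemma evecZ b c u : evec b (c *: u) = c *: evec b u.
Proof. by rewrite scaler_sumr; apply: eq_bigr => i _; rewrite mxE scalerA. Qed.

Lemma evec_basis b i : evec b (basis i) = gamma R (i, b i).
Proof.
rewrite /evec (bigD1 i) //= big1 ?addr0; first by rewrite mxE !eqxx scale1r.
by move=> j /negPf ji; rewrite mxE ji scale0r.
Qed.

Lemma evec_ext b c u :
  (forall i, b i = c i \/ u i 0 = 0) -> evec b u = evec c u.
Proof.
by move=> bc; apply: eq_bigr => i _; case: (bc i) => ->; rewrite ?scale0r.
Qed.

Definition dot u v : R := \sum_i u i 0 * v i 0.

Lemma dot_basis u i : dot (basis i) u = u i 0.
Proof.
rewrite /dot (bigD1 i) //= big1 ?addr0; first by rewrite mxE !eqxx mul1r.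
by move=> j /negPf ji; rewrite mxE ji mul0r.
Qed.

Lemma dotC u v : dot u v = dot v u.
Proof. by apply: eq_bigr => i _; rewrite mulrC. Qed.

Lemma dot_row m (K : 'M[R]_l) u : dot (row m K)^T u = (K *m u) m 0.
Proof. by rewrite mxE; apply: eq_bigr => i _; rewrite !mxE. Qed.

Lemma evec_clifford b c u v : evec b u * evec c v + evec c v * evec b u =
  (\sum_i u i 0 * v i 0 *+ (b i != c i))%:M.
Proof.
have mulE (b1 c1 : 'I_l -> bool) u1 v1 : evec b1 u1 * evec c1 v1 =
    \sum_i \sum_j (u1 i 0 * v1 j 0) *: (gamma R (i, b1 i) * gamma R (j, c1 j)).
  rewrite mulr_suml; apply: eq_bigr => i _; rewrite mulr_sumr; apply: eq_bigr => j _.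
  by rewrite -!mulmxE -scalemxAl -scalemxAr scalerA.
rewrite !mulE [X in _ + X]exchange_big -big_split raddf_sum /=.
apply: eq_bigr => i _; rewrite -big_split (bigD1 i) //= big1 ?addr0; last first.
  move=> j ji; rewrite [v j 0 * _]mulrC -scalerDr clifford_relation.
  by rewrite /opp_sidx xpair_eqE (negPf ji) /= raddf0 scaler0.
rewrite [v i 0 * _]mulrC -scalerDr clifford_relation.
rewrite /opp_sidx xpair_eqE eqxx /= scale_scalar_mx mulr_natr.
by case: (b i); case: (c i).
Qed.

Lemma evec_anti b u v : evec b u * evec b v = - (evec b v * evec b u).
Proof.
apply/eqP; rewrite -addr_eq0 evec_clifford big1 ?raddf0 // => i _.
by rewrite eqxx.
Qed.

(** The diagonal terms are treated apart: antisymmetry only gives twice the square. *)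
Lemma evec_sqr b u : evec b u * evec b u = 0.
Proof.
have mulZ (c : R) (x : A) : (c *: x) * (c *: x) = (c * c) *: (x * x).
  by rewrite -!mulmxE -scalemxAl -scalemxAr scalerA.
suff sq (s : seq 'I_l) : let x := \sum_(i <- s) u i 0 *: gamma R (i, b i) in x * x = 0.
  exact: sq.
elim: s => [|i s IHs] /=; first by rewrite big_nil mulr0.
rewrite big_cons; set x := u i 0 *: _; set y := \sum_(i <- s) _.
have xx : x * x = 0 by rewrite mulZ -mulmxE gamma_sqr scaler0.
have xy : x * y = - (y * x).
  rewrite mulr_sumr mulr_suml -sumrN; apply: eq_bigr => j _.
  by rewrite /x -!evec_basis -!evecZ evec_anti.
by rewrite mulrDl !mulrDr xx xy [y * y]IHs add0r addr0 addNr.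
Qed.

Lemma evec_isotropic b u v : isotropic (evec b u) (evec b v).
Proof. by split; rewrite ?evec_sqr // evec_anti. Qed.

Lemma evec_dual b u v : evec b u * evec (negb_fun b) v + evec (negb_fun b) v * evec b u
  = (dot u v)%:M.
Proof.
rewrite evec_clifford; congr _%:M; apply: eq_bigr => i _.
by rewrite /negb_fun; case: (b i).
Qed.

(** Transvections are additive in both vectors, and the terms with i = j are
    trivial. *)
Lemma transv_evec (H : set G) b u v : is_subgroup H ->
  (forall i j, i != j ->
     H (transv (evec b (basis i)) ((u i 0 * v j 0) *: evec b (basis j)))) ->
  H (transv (evec b u) (evec b v)).
Proof.
move=> [H1 HM HV] Hij.
have Hsum (w : 'cV[R]_l) (F : 'I_l -> 'cV[R]_l) :
    (forall j, H (transv (evec b w) (evec b (F j)))) ->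
    H (transv (evec b w) (evec b (\sum_j F j))).
  move=> HF; apply: (big_ind (fun x => H (transv (evec b w) (evec b x)))).
  - by rewrite -(scale0r 0) evecZ scale0r transvx0 ?evec_sqr.
  - by move=> x y Hx Hy; rewrite evecD transvDr; [exact: HM|exact: evec_isotropic..].
  - by move=> j _; exact: HF.
have decE (w : 'cV[R]_l) : w = \sum_j w j 0 *: basis j.
  apply/matrixP => i k; rewrite ord1 summxE (bigD1 i) //= big1 ?addr0.
    by rewrite !mxE !eqxx mulr1.
  by move=> j /negPf ji; rewrite !mxE eq_sym ji mulr0.
rewrite (decE v); apply: (Hsum) => j.
rewrite evecZ transv_swap; last exact: evec_isotropic.
rewrite -evecZ {1}(decE u) scaler_sumr; apply: (Hsum) => i.
rewrite !evecZ scalerA; have [->|ij] := eqVneq i j; first by rewrite transvxx ?evec_sqr.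
rewrite transv_swap; last exact: evec_isotropic.
by rewrite mulNr opprK mulrC; exact: Hij.
Qed.

End Lagrangians.

(** * Ideals, and the Levi subgroups of type A *)

Section Ideals.
Variables (R : comPzRingType) (I : set R).
Hypothesis idI : is_ideal I.

Lemma is_ideal0 : I 0. Proof. by case: idI. Qed.
Lemma is_idealD x y : I x -> I y -> I (x + y). Proof. by case: idI => _ + _; apply. Qed.
Lemma is_idealMl x y : I y -> I (x * y). Proof. by case: idI => _ _; apply. Qed.
Lemma is_idealMr x y : I x -> I (x * y). Proof. by rewrite mulrC; apply: is_idealMl. Qed.
Lemma is_idealN x : I x -> I (- x). Proof. by rewrite -mulN1r; apply: is_idealMl. Qed.
Lemma is_idealB x y : I x -> I y -> I (x - y).
Proof. by move=> Ix Iy; apply: is_idealD => //; apply: is_idealN. Qed.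
Lemma is_ideal_sum (T : finType) (F : T -> R) :
  (forall i, I (F i)) -> I (\sum_i F i).
Proof.
by move=> IF; apply: (big_ind I) => [|x y|i _]; [exact: is_ideal0|exact: is_idealD|].
Qed.

Definition mx_in m n (M : 'M[R]_(m, n)) := forall i j, I (M i j).

Lemma mx_inD m n (M N : 'M[R]_(m, n)) : mx_in M -> mx_in N -> mx_in (M + N).
Proof. by move=> MI NI i j; rewrite mxE; apply: is_idealD. Qed.

Lemma mx_in_mull m n p (M : 'M[R]_(m, n)) (N : 'M[R]_(n, p)) :
  mx_in N -> mx_in (M *m N).
Proof. by move=> NI i j; rewrite mxE; apply: is_ideal_sum => k; apply: is_idealMl. Qed.

Lemma mx_in_mulr m n p (M : 'M[R]_(m, n)) (N : 'M[R]_(n, p)) :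
  mx_in M -> mx_in (M *m N).
Proof. by move=> MI i j; rewrite mxE; apply: is_ideal_sum => k; apply: is_idealMr. Qed.

End Ideals.

Lemma is_ideal_setT (R : comPzRingType) : is_ideal [set: R].
Proof. by []. Qed.

Section Siegel.
Variables (R : comPzRingType) (l : nat).
Local Notation A := 'M[R]_#|{: {set 'I_l}}|.
Local Notation G := (spinGL R l).
Implicit Types (b c : 'I_l -> bool) (u v : 'cV[R]_l) (I J : set R) (i j k : 'I_l).

(** With s_i the sign given by b i, these are the roots s_i e_i - s_j e_j: the
    subsystem of type A_{l-1} formed by the roots of the Levi subgroup of the
    stabiliser of the span of [evec b]. *)
Definition Aroots b : {set Droot l} :=
  [set r | ((val r).1.2 == b (val r).1.1) != ((val r).2.2 == b (val r).2.1)]%SET.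

Definition levi_gens b J : set G := [set g | exists i j t,
  [/\ i != j, J t & g = transv (gamma R (i, b i)) (t *: gamma R (j, ~~ b j))]].

Lemma gammaE b i : gamma R (i, b i) = evec b (basis R i).
Proof. by rewrite evec_basis. Qed.

Lemma gammaNE b i : gamma R (i, ~~ b i) = evec (negb_fun b) (basis R i).
Proof. by rewrite evec_basis. Qed.

Lemma isotropic_dual b u v : dot u v = 0 ->
  isotropic (evec b u) (evec (negb_fun b) v).
Proof.
move=> uv; split; rewrite ?evec_sqr //; apply/eqP.
by rewrite -addr_eq0 evec_dual uv raddf0.
Qed.

Lemma isotropic_gamma (p q : sidx l) : p.1 != q.1 -> isotropic (gamma R p) (gamma R q : A).
Proof.
move=> pq; split; rewrite -?mulmxE ?gamma_sqr //.
apply/eqP; rewrite -addr_eq0 clifford_relation.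
have -> : (q == opp_sidx p) = false.
  by apply: contraNF pq => /eqP ->.
by rewrite raddf0.
Qed.

Lemma root_elt_transv (r : Droot l) t :
  root_elt r t = transv (gamma R (val r).1) (t *: gamma R (val r).2).
Proof.
apply: unit_val_inj; rewrite unit_transv; last first.
  apply: isotropicZ; apply: isotropic_gamma; have := valP r; rewrite ltnNge => /negP.
  by apply: contra_not_neq => ->.
by rewrite /unit_val /= /root_op -!mulmxE -scalemxAr.
Qed.

Lemma transv_root_elt (p q : sidx l) t : p.1 != q.1 ->
  exists r s, [/\ s = t \/ s = - t, (val r = (p, q)) \/ (val r = (q, p)) &
    transv (gamma R p) (t *: gamma R q) = root_elt r s].
Proof.
move=> pq; have /orP[lt|lt] : (p.1 < q.1)%N || (q.1 < p.1)%N by rewrite -neq_ltn.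
  by exists (exist _ (p, q) lt), t; rewrite root_elt_transv; split=> //; left.
exists (exist _ (q, p) lt), (- t); rewrite root_elt_transv; split; [by right|by right|].
by rewrite /= [LHS]transv_swap //; exact: isotropic_gamma.
Qed.

Lemma levi_gensE b J : is_ideal J ->
  [set g | exists r s, [/\ r \in Aroots b, J s & g = root_elt r s]] = levi_gens b J.
Proof.
move=> idJ; apply/seteqP; split=> g.
  move=> [r [s [rb Js ->]]]; rewrite root_elt_transv; move: rb (valP r); rewrite inE.
  case: (val r) => -[i c] [j d] /= rb ij.
  have {}ij : i != j by apply: contraTneq ij => ->; rewrite ltnn.
  case: (eqVneq c (b i)) rb => [->|cb] rb.
    have -> : d = ~~ b j by case: (d) (b j) rb => [] [].
    by exists i, j, s.
  have -> : d = b j by case: (d) (b j) rb => [] [].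
  have -> : c = ~~ b i by case: (c) (b i) cb => [] [].
  exists j, i, (- s); split; [by rewrite eq_sym|exact: is_idealN|].
  by rewrite transv_swap //; exact: isotropic_gamma.
move=> [i [j [t [ij Jt ->]]]].
have [r [s [st vr ->]]] := @transv_root_elt (i, b i) (j, ~~ b j) t ij.
exists r, s; split=> //; last by case: st => -> //; apply: is_idealN.
by rewrite inE; case: vr => -> /=; rewrite eqxx; case: (b j).
Qed.

(** Every root unipotent is a transvection of a standard pair of vectors of the
    Lagrangian of b or of the opposite one, or a generator of the Levi subgroup. *)
Lemma root_eltP b (r : Droot l) t : exists i j, i != j /\
  [\/ root_elt r t = transv (evec b (basis R i)) (t *: evec b (basis R j)),
      root_elt r t = transv (evec (negb_fun b) (basis R i))
                            (t *: evec (negb_fun b) (basis R j)) |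
      exists s, (s = t \/ s = - t) /\ root_elt r t =
        transv (evec b (basis R i)) (s *: evec (negb_fun b) (basis R j))].
Proof.
rewrite root_elt_transv; have := valP r; case: (val r) => -[i s] [j s'] /= ij.
have {}ij : i != j by apply: contraTneq ij => ->; rewrite ltnn.
have ji : j != i by rewrite eq_sym.
have signE k (s0 : bool) : s0 = b k \/ s0 = ~~ b k.
  by case: s0; case: (b k); [left|right|right|left].
case: (signE i s) => ->; case: (signE j s') => ->; rewrite ?gammaE ?gammaNE.
- by exists i, j; split=> //; constructor 1.
- by exists i, j; split=> //; constructor 3; exists t; split=> //; left.
- exists j, i; split=> //; constructor 3; exists (- t); split; first by right.
  by rewrite transv_swap // -!gammaE; apply: isotropic_gamma.
- by exists i, j; split=> //; constructor 2.
Qed.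

Definition levi b : set G := @E_abs R l (Aroots b).
Definition levi_rel b I : set G := E_rel (Aroots b) I.

Lemma leviE b : levi b = generated (levi_gens b setT).
Proof.
rewrite -levi_gensE; last exact: is_ideal_setT.
rewrite /levi /E_abs; congr (generated _).
by apply/seteqP; split=> g /= [r [s H]]; exists r, s; case: H.
Qed.

Lemma levi_relE b I : is_ideal I ->
  levi_rel b I = normal_closure (levi b) (generated (levi_gens b I)).
Proof. by move=> idI; rewrite -levi_gensE. Qed.

Lemma levi_subgroup b : is_subgroup (levi b).
Proof. exact: generated_subgroup. Qed.

Lemma levi_rel_normal b I : is_ideal I -> is_normal_in (levi b) (levi_rel b I).
Proof.
move=> idI; apply: normal_closure_normal; first exact: levi_subgroup.
apply: generated_min; first exact: levi_subgroup.
by move=> g [r [s [rb _ ->]]]; apply: mem_generated; exists r, s.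
Qed.

Lemma levi_rel_subgroup b I : is_ideal I -> is_subgroup (levi_rel b I).
Proof. by move=> /(levi_rel_normal b)[]. Qed.

Lemma levi_rel_sub b I : is_ideal I -> levi_rel b I `<=` levi b.
Proof. by move=> /(levi_rel_normal b)[]. Qed.

Lemma mem_levi b i j t : i != j ->
  levi b (transv (evec b (basis R i)) (t *: evec (negb_fun b) (basis R j))).
Proof.
move=> ij; rewrite leviE -gammaE -gammaNE; apply: mem_generated.
by exists i, j, t.
Qed.

Lemma mem_levi_rel b I i j t : is_ideal I -> i != j -> I t ->
  levi_rel b I (transv (evec b (basis R i)) (t *: evec (negb_fun b) (basis R j))).
Proof.
move=> idI ij It; rewrite levi_relE // -gammaE -gammaNE.
apply: mem_normal_closure; apply: mem_generated.
by exists i, j, t.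
Qed.

Lemma Aroots_neg b : Aroots (negb_fun b) = Aroots b.
Proof.
apply/setP => r; rewrite !inE /negb_fun.
by case: (val r) => -[i []] [j []] /=; case: (b i); case: (b j).
Qed.

Lemma levi_neg b : levi (negb_fun b) = levi b.
Proof. by rewrite /levi Aroots_neg. Qed.

Lemma levi_rel_neg b I : levi_rel (negb_fun b) I = levi_rel b I.
Proof. by rewrite /levi_rel Aroots_neg. Qed.

Definition acts_by b g (K : 'M[R]_l) := forall u, act g (evec b u) = evec b (K *m u).

(** The inverse matrix is kept along, for the congruences modulo I of both. *)
Definition acts_inv b g (K K' : 'M[R]_l) :=
  [/\ K *m K' = 1%:M, K' *m K = 1%:M & acts_by b g K].

Lemma acts_invV b g K K' : acts_inv b g K K' -> acts_inv b g^-1%g K' K.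
Proof.
move=> [KK' K'K gK]; split=> // u.
by rewrite -{1}[u]mul1mx -KK' -mulmxA -gK -actM mulVg act1.
Qed.

Lemma acts_invM b g h K K' H H' :
  acts_inv b g K K' -> acts_inv b h H H' -> acts_inv b (g * h)%g (K *m H) (H' *m K').
Proof.
move=> [KK' K'K gK] [HH' H'H hH]; split.
- by rewrite mulmxA -(mulmxA K) HH' mulmx1.
- by rewrite mulmxA -(mulmxA H') K'K mulmx1.
- by move=> u; rewrite actM hH gK mulmxA.
Qed.

Lemma acts_inv1 b : acts_inv b 1%g 1%:M 1%:M.
Proof. by split=> [||u]; rewrite ?mul1mx // act1. Qed.

Lemma act_levi_gen b i j t u : i != j ->
  act (transv (evec b (basis R i)) (t *: evec (negb_fun b) (basis R j))) (evec b u)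
  = evec b (u + (t * u j 0) *: basis R i).
Proof.
move=> ij; rewrite -[t *: evec _ _]evecZ.
have iso : isotropic (evec b (basis R i)) (evec (negb_fun b) (t *: basis R j)).
  by apply: isotropic_dual; rewrite dot_basis !mxE (negPf ij) mulr0.
rewrite (@act_transv _ _ _ _ _ 0 (t * u j 0) iso) ?scale0r ?subr0 ?evecD ?evecZ //.
  by rewrite evec_anti addNr raddf0.
rewrite -evecZ addrC evec_dual; congr _%:M.
transitivity (dot (basis R j) (t *: u)); last by rewrite dot_basis mxE.
by apply: eq_bigr => k _; rewrite !mxE; ring.
Qed.

Lemma acts_inv_gen b i j t : i != j ->
  acts_inv b (transv (evec b (basis R i)) (t *: evec (negb_fun b) (basis R j)))
    (1%:M + t *: delta_mx i j) (1%:M - t *: delta_mx i j).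
Proof.
move=> ij.
have NN : (t *: delta_mx i j : 'M[R]_l) *m (t *: delta_mx i j) = 0.
  by rewrite -scalemxAl -scalemxAr mul_delta_mx_cond eq_sym (negPf ij) !scaler0.
split.
- by rewrite mulmxDl mul1mx mulmxBr mulmx1 NN subr0 subrK.
- by rewrite mulmxBl mul1mx mulmxDr mulmx1 NN addr0 addrK.
move=> u; rewrite act_levi_gen //; congr evec.
rewrite mulmxDl mul1mx; congr (_ + _); rewrite -scalemxAl -scalerA; congr (_ *: _).
apply/matrixP => k m; rewrite ord1 !mxE (bigD1 j) //= big1 ?addr0.
  by rewrite !mxE !eqxx !andbT mulrC.
by move=> n /negPf nj; rewrite mxE nj andbF mul0r.
Qed.

Lemma levi_acts b g : levi b g -> exists K K', acts_inv b g K K'.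
Proof.
rewrite leviE; move: g; apply: generated_min.
  split=> [|g h [K [K' gK]] [H [H' hH]]|g [K [K' gK]]].
  - by exists 1%:M, 1%:M; exact: acts_inv1.
  - by exists (K *m H), (H' *m K'); exact: acts_invM.
  - by exists K', K; exact: acts_invV.
move=> _ [i [j [t [ij _ ->]]]]; rewrite gammaE gammaNE.
by exists (1%:M + t *: delta_mx i j), (1%:M - t *: delta_mx i j); exact: acts_inv_gen.
Qed.

(** Congruence to 1 modulo I survives conjugation by the matrices of the whole
    Levi subgroup. *)
Lemma levi_rel_acts b I g : is_ideal I -> levi_rel b I g ->
  exists K K', [/\ acts_inv b g K K', mx_in I (K - 1%:M) & mx_in I (K' - 1%:M)].
Proof.
move=> idI; rewrite levi_relE //; move: g.
pose N : set G := [set g | exists K K',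
  [/\ acts_inv b g K K', mx_in I (K - 1%:M) & mx_in I (K' - 1%:M)]].
have congM (K H : 'M[R]_l) : mx_in I (K - 1%:M) -> mx_in I (H - 1%:M) ->
    mx_in I (K *m H - 1%:M).
  move=> KI HI; have -> : K *m H - 1%:M = (K - 1%:M) *m H + (H - 1%:M).
    by rewrite mulmxBl mul1mx addrA subrK.
  by apply: mx_inD => //; apply: mx_in_mulr.
have sgN : is_subgroup N.
  split=> [|g h [K [K' [gK KI K'I]]] [H [H' [hH HI H'I]]]|g [K [K' [gK KI K'I]]]].
  - exists 1%:M, 1%:M; split; [exact: acts_inv1|..];
      by move=> i j; rewrite subrr mxE; exact: is_ideal0.
  - exists (K *m H), (H' *m K'); split; [exact: acts_invM|exact: congM..].
  - by exists K', K; split=> //; exact: acts_invV.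
have sub : generated (levi_gens b I) `<=` N.
  apply: generated_min => // _ [i [j [t [ij It ->]]]]; rewrite gammaE gammaNE.
  exists (1%:M + t *: delta_mx i j), (1%:M - t *: delta_mx i j).
  split; [exact: acts_inv_gen|..] => k m; rewrite addrAC subrr add0r !mxE.
    exact: is_idealMr.
  by apply: is_idealN => //; apply: is_idealMr.
suff nN : is_normal_in (levi b) (N `&` levi b).
  move=> g /(normal_closure_min nN)[] // x gx; split; first exact: sub.
  move: x gx; apply: generated_min; first exact: levi_subgroup.
  by move=> _ [i [j [t [ij It ->]]]]; rewrite gammaE gammaNE; apply: mem_levi.
split; first by apply: subgroupI => //; exact: levi_subgroup.
  by move=> x [].
move=> g x gb [[H [H' [xH HI H'I]]] xb]; split; last first.
  exact: (subgroup_conjV (levi_subgroup b) gb xb).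
have [K [K' gK]] := levi_acts gb; have [KK' K'K _] := gK.
have conjI (M : 'M[R]_l) : mx_in I (M - 1%:M) -> mx_in I (K *m M *m K' - 1%:M).
  move=> MI; have -> : K *m M *m K' - 1%:M = K *m (M - 1%:M) *m K'.
    by rewrite mulmxBr mulmx1 mulmxBl KK'.
  by apply: mx_in_mulr => //; apply: mx_in_mull.
exists (K *m H *m K'), (K *m H' *m K'); split; [|exact: conjI..].
rewrite -(mulmxA K H'); apply: acts_invM; last exact: acts_invV.
exact: acts_invM.
Qed.

End Siegel.

(** * The unipotent radicals of the Siegel parabolic subgroups *)

Section Radicals.
Variables (R : comPzRingType) (l : nat).
Local Notation A := 'M[R]_#|{: {set 'I_l}}|.
Local Notation G := (spinGL R l).
Implicit Types (b c : 'I_l -> bool) (u v : 'cV[R]_l) (I J : set R) (i j k : 'I_l).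
Local Notation "''d_' i" := (basis R i) (at level 8, i at level 2, format "''d_' i").

(** The unipotent radical of the stabiliser of the span of [evec b], with
    coefficients in J. *)
Definition radical b J : set G := generated [set g | exists i j t,
  J t /\ g = transv (evec b 'd_i) (t *: evec b 'd_j)].

Lemma radical_subgroup b J : is_subgroup (radical b J).
Proof. exact: generated_subgroup. Qed.

Lemma mem_radical b J i j t : J t ->
  radical b J (transv (evec b 'd_i) (t *: evec b 'd_j)).
Proof. by move=> Jt; apply: mem_generated; exists i, j, t. Qed.

Lemma radicalS b I J : I `<=` J -> radical b I `<=` radical b J.
Proof.
by move=> IJ; apply: generatedS => _ [i [j [t [/IJ Jt ->]]]]; exists i, j, t.
Qed.

Lemma radical_evec b J u v : (forall i j, J (u i 0 * v j 0)) ->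
  radical b J (transv (evec b u) (evec b v)).
Proof.
by move=> Juv; apply: (transv_evec (radical_subgroup b J)) => i j _; apply: mem_radical.
Qed.

Lemma radical_abelian b x y :
  radical b setT x -> radical b setT y -> (x * y = y * x)%g.
Proof.
apply: generated_abelian => _ _ [i [j [t [_ ->]]]] [k [m [s [_ ->]]]].
rewrite -!evecZ; set u := 'd_i; set v := _ *: 'd_j; set w := 'd_k; set z := _ *: 'd_m.
have comm2 p q r : evec b p * evec b q * evec b r = evec b r * (evec b p * evec b q).
  rewrite -mulrA (evec_anti b q) mulrN (mulrA (evec b p)) (evec_anti b p r) mulNr opprK.
  by rewrite mulrA.
apply: unit_val_inj.
rewrite !unit_valM (unit_transv (evec_isotropic b u v)).
rewrite (unit_transv (evec_isotropic b w z)).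
have xy : evec b u * evec b v * (evec b w * evec b z) =
    evec b w * evec b z * (evec b u * evec b v).
  by rewrite mulrA comm2 -mulrA comm2 mulrA.
by rewrite !mulrDl !mul1r !mulrDr !mulr1 xy -!addrA; congr (_ + _); rewrite addrCA.
Qed.

Lemma radical_conj b J g x : is_ideal J ->
  levi b g -> radical b J x -> radical b J (g * x * g^-1)%g.
Proof.
move=> idJ gb; move: x; apply: generated_conj => _ [i [j [t [Jt ->]]]].
have [K [K' [_ _ gK]]] := levi_acts gb.
rewrite -evecZ transv_act ?gK; last exact: evec_isotropic.
apply: radical_evec => k m; apply: is_idealMl => //.
by rewrite -scalemxAr mxE; apply: is_idealMr.
Qed.

(** As m acts by 1 + N with N over I, conjugation by m multiplies T(x, y) by the
    transvections T(N x, y) and T(x + N x, N y). *)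
Lemma radical_comm b I m q : is_ideal I ->
  levi_rel b I m -> radical b setT q -> radical b I (m * q * m^-1 * q^-1)%g.
Proof.
move=> idI mI.
have [K [K' [[_ _ mK] KI _]]] := levi_rel_acts idI mI.
have mb : levi b m by exact: levi_rel_sub mI.
have conj x : radical b setT x -> radical b setT (m * x * m^-1)%g.
  exact: radical_conj (is_ideal_setT R) mb.
have IT x : radical b I x -> radical b setT x by apply: radicalS.
have [U1 UM UV] := radical_subgroup b I.
have [T1 TM TV] := radical_subgroup b setT.
pose P : set G := [set q | radical b setT q /\ radical b I (m * q * m^-1 * q^-1)%g].
suff sub : radical b setT `<=` P by move=> /sub[].
apply: generated_min.
  split; first by split; [exact: T1|rewrite mulg1 mulgV mul1g invg1].
    move=> x y [xT Px] [yT Py]; split; first exact: TM.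
    have -> : (m * (x * y) * m^-1 * (x * y)^-1 =
               (m * x * m^-1 * x^-1) * (m * y * m^-1 * y^-1))%g.
      have xc : (x^-1 * (m * y * m^-1 * y^-1) = (m * y * m^-1 * y^-1) * x^-1)%g.
        exact: radical_abelian (TV _ xT) (IT _ Py).
      by rewrite -(mulgA _ x^-1%g) xc !invgM !mulgA mulgVK.
    exact: UM.
  move=> x [xT Px]; split; first exact: TV.
  have -> : (m * x^-1 * m^-1 * x^-1^-1 = (m * x * m^-1 * x^-1)^-1)%g.
    rewrite !invgM !invgK.
    have -> : (x * (m * (x^-1 * m^-1)) = (m * (x^-1 * m^-1)) * x)%g.
      apply: (radical_abelian xT); rewrite mulgA; apply: conj; exact: TV.
    by rewrite !mulgA.
  exact: UV.
move=> _ [i [j [t [_ ->]]]]; split; first exact: mem_radical.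
rewrite -evecZ transv_act ?mK; last exact: evec_isotropic.
pose N := K - 1%:M; have KE w : K *m w = w + N *m w.
  by rewrite mulmxBl mul1mx addrC subrK.
rewrite !KE !evecD transvDr; [|by rewrite -?evecD; exact: evec_isotropic..].
have NI w : mx_in I (N *m w) by apply: mx_in_mulr.
set w := 'd_i; set z := _ *: 'd_j.
rewrite transvDl; [|exact: evec_isotropic..].
rewrite -evecD.
have H1 : radical b I (transv (evec b (N *m w)) (evec b z)).
  by apply: radical_evec => k p; apply: is_idealMr => //; exact: NI.
have H2 : radical b I (transv (evec b (w + N *m w)) (evec b (N *m z))).
  by apply: radical_evec => k p; apply: is_idealMl => //; exact: NI.
set x := transv (evec b w) _.
have xT : radical b setT x by apply: radical_evec.
have H12 := UM _ _ H1 H2.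
by rewrite -(mulgA x) (radical_abelian xT (IT _ H12)) mulgK.
Qed.

(** Such b and c give maximal isotropic subspaces meeting in corank one. *)
Definition flipped n b c := forall i, c i = b i (+) (i == n).

Lemma flipped_sym n b c : flipped n b c -> flipped n c b.
Proof. by move=> bc i; rewrite bc -addbA addbb addbF. Qed.

Lemma flipped_neg n b c : flipped n b c -> flipped n (negb_fun b) (negb_fun c).
Proof. by move=> bc i; rewrite /negb_fun bc addNb. Qed.

Lemma evec_flipped n b c u : flipped n b c -> u n 0 = 0 -> evec b u = evec c u.
Proof.
move=> bc un; apply: evec_ext => i; rewrite bc.
by have [->|_] := eqVneq i n; [right | left; rewrite addbF].
Qed.

Lemma evec_flipped_basis n b c : flipped n b c ->
  evec b 'd_n = evec (negb_fun c) 'd_n.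
Proof. by move=> bc; rewrite !evec_basis /negb_fun bc eqxx addbT negbK. Qed.

Lemma basis0 i j : i != j -> 'd_i j 0 = 0.
Proof. by move=> ij; rewrite mxE eq_sym (negPf ij). Qed.

Lemma flipped_levi n b c i t : flipped n b c -> i != n ->
  levi c (transv (evec b 'd_i) (t *: evec b 'd_n)).
Proof.
move=> bc ni; rewrite (evec_flipped bc) ?basis0 // (evec_flipped_basis bc).
exact: mem_levi.
Qed.

Lemma flipped_levi_rel n b c I i t : is_ideal I -> flipped n b c -> i != n -> I t ->
  levi_rel c I (transv (evec b 'd_i) (t *: evec b 'd_n)).
Proof.
move=> idI bc ni It; rewrite (evec_flipped bc) ?basis0 // (evec_flipped_basis bc).
exact: mem_levi_rel.
Qed.

(** A root of the radical of b is a root of the Levi subgroup or of the radical of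
    c, according to whether it involves the flipped coordinate. *)
Lemma radical_split n b c I x : is_ideal I -> flipped n b c -> radical b I x ->
  exists y z, [/\ levi_rel c I y /\ radical b I y, radical c I z /\ radical b I z
                & x = (y * z)%g].
Proof.
move=> idI bc xI.
suff /mulg_setP[y [z [[? ?] [? ?] ->]]] :
    mulg_set (levi_rel c I `&` radical b I) (radical c I `&` radical b I) x.
  by exists y, z.
move: x xI.
have sgL := levi_rel_subgroup c idI.
have IT : radical b I `<=` radical b setT by apply: radicalS.
have sg1 := subgroupI sgL (radical_subgroup b I).
have sg2 := subgroupI (radical_subgroup c I) (radical_subgroup b I).
apply: generated_min.
  apply: (mulg_set_subgroup sg1 sg2) => x y [_ /IT xT] [_ /IT yT].
  exact: radical_abelian xT yT.
case: sg1 sg2 => [one1 _ _] [one2 _ _] _ [i [j [t [It ->]]]].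
have Ub : radical b I (transv (evec b 'd_i) (t *: evec b 'd_j)) by apply: mem_radical.
have [ij|ij] := eqVneq i j.
  rewrite ij transvxx ?evec_sqr // -[1%g]mulg1; exact: mem_mulg_set.
have [jn|jn] := eqVneq j n.
  rewrite -[transv _ _]mulg1; apply: mem_mulg_set => //; split=> //.
  by rewrite jn; apply: flipped_levi_rel bc _ _; rewrite // -jn.
have [iN|iN] := eqVneq i n.
  rewrite -[transv _ _]mulg1; apply: mem_mulg_set => //; split=> //.
  rewrite transv_swap; last exact: evec_isotropic.
  by rewrite iN; apply: flipped_levi_rel bc _ _ => //; exact: is_idealN.
rewrite -[transv _ _]mul1g; apply: mem_mulg_set => //; split=> //.
by rewrite !(evec_flipped bc) ?basis0 //; apply: mem_radical.
Qed.

End Radicals.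

(** * Stable rank *)

Section StableRank.
Variables (R : comPzRingType) (I : set R).
Hypothesis idI : is_ideal I.

Definition SR2 := forall a1 a2 z c1 c2 c3 : R,
  I (a1 - 1) -> I a2 -> I z -> c1 * a1 + c2 * a2 + c3 * z = 1 ->
  exists b1 b2 d1 d2, [/\ I b1, I b2 &
    d1 * (a1 + z * b1) + d2 * (a2 + z * b2) = 1].

Lemma SR_SR2 : SR 2 I -> SR2.
Proof.
move=> sr a1 a2 z c1 c2 c3 I1 I2 Iz eq1.
pose a : 'rV[R]_2 := \row_j (if j == 0 then a1 else a2).
have [|b Ib [_ [d]]] := sr a z.
  split.
    move=> i; rewrite -[i]splitK; case: (split i) => j /=.
      rewrite row_mxEl mxE -val_eqE /=; case: (j == 0 :> nat) => //.
      by rewrite subr0.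
    by rewrite row_mxEr [j]ord1 mxE /= subr0 mulr1n.
  exists (fun i : 'I_(2 + 1) => nth 0 [:: c1; c2; c3] i).
  rewrite big_split_ord !big_ord_recl !big_ord0 !row_mxEl row_mxEr !mxE /= !mulr1n.
  by rewrite !addr0.
rewrite !big_ord_recl big_ord0 addr0 !mxE /= => d1.
exists (b 0 0), (b 0 (lift 0 0)), (d 0), (d (lift 0 0)).
by split; [exact: Ib|exact: Ib|].
Qed.

(** If sr(I) = 1, apply SR 1 to the row (a1, c2 a2 + c3 z) and keep only the added
    multiple of z: what remains still spans the same ideal together with a2. *)
Lemma sr_le_SR2 : sr_le I 2 -> SR2.
Proof.
case=> -[|[|[|k]]] [k1 srk _] // _; last exact: SR_SR2.
move=> a1 a2 z c1 c2 c3 I1 I2 Iz eq1.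
pose w := c2 * a2 + c3 * z.
have Iw : I w by apply: is_idealD => //; apply: is_idealMl.
have [|b Ib [_ [d]]] := srk a1%:M w.
  split.
    move=> i; rewrite -[i]splitK; case: (split i) => j /=.
      by rewrite row_mxEl [j]ord1 mxE /= mulr1n.
    by rewrite row_mxEr [j]ord1 mxE /= subr0 mulr1n.
  exists (fun i : 'I_(1 + 1) => nth 0 [:: c1; 1] i).
  rewrite big_split_ord !big_ord1 row_mxEl row_mxEr !mxE /= !mulr1n.
  by rewrite mul1r -eq1 addrA.
rewrite big_ord1 !mxE mulr1n => d1; set t := b 0 0 in d1.
exists (c3 * t), 0, (d 0), (d 0 * t * c2); split.
- by apply: is_idealMl => //; apply: Ib.
- exact: is_ideal0.
- by rewrite -d1 /w; ring.
Qed.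

(** Write x, y for the n-th coordinates of X, Y and c1, c2 for those of r, s. If w is
    a r + b s outside n and 0 at n, then the pair of [dot w X] and [dot w Y] is the
    row (a, b) times the matrix 1 - C A, with C the column (c1, c2) and A the row
    (x, y). Its determinant is z = 1 - c1 x - c2 y, so by the adjugate every pair
    divisible by z is obtained, in particular the one provided by the stable range
    condition for the row (y, x, z). *)
Lemma frame_row_unimodular (l : nat) (n : 'I_l) (X Y r s : 'cV[R]_l) : SR2 ->
  dot r X = 1 -> dot r Y = 0 -> dot s X = 0 -> dot s Y = 1 ->
  I (X n 0) -> I (Y n 0 - 1) -> I (r n 0) -> I (s n 0 - 1) ->
  exists y : 'cV[R]_l, [/\ y n 0 = 0, forall i, I (y i 0) &
    exists c d, c * (X n 0 + dot y X) + d * (Y n 0 + dot y Y) = 1].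
Proof.
move=> sr rX rY sX sY IX IY Ir Is.
set x := X n 0 in IX *; set y := Y n 0 in IY *.
set c1 := r n 0 in Ir; set c2 := s n 0 in Is.
pose z := 1 - (c1 * x + c2 * y).
have Iz : I z.
  have -> : z = - ((c2 - 1) * y + (y - 1)) - c1 * x by rewrite /z; ring.
  apply: is_idealB => //; last exact: is_idealMl.
  by apply: is_idealN => //; apply: is_idealD => //; apply: is_idealMr.
have [|v2 [v1 [d1 [d2 [I2 I1 eq1]]]]] := sr y x z c2 c1 1 IY IX Iz.
  by rewrite /z; ring.
pose a := v1 * (1 - c2 * y) + v2 * (c2 * x).
pose b := v1 * (c1 * y) + v2 * (1 - c1 * x).
pose w : 'cV[R]_l := \col_i (if i == n then 0 else a * r i 0 + b * s i 0).
have dotw (Z : 'cV[R]_l) :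
    dot w Z = a * (dot r Z - c1 * Z n 0) + b * (dot s Z - c2 * Z n 0).
  rewrite /dot [LHS](bigD1 n) // [in RHS](bigD1 n) //= [in X in b * X](bigD1 n) //=.
  rewrite mxE eqxx mul0r add0r /c1 /c2 !(addrC (_ n 0 * _)) !addrK.
  rewrite !mulr_sumr -big_split; apply: eq_bigr => i /negPf ni /=.
  by rewrite mxE ni; ring.
exists w; split; first by rewrite mxE eqxx.
  move=> i; rewrite mxE; case: eqP => _; first exact: is_ideal0.
  have Ia : I a by apply: is_idealD => //; apply: is_idealMr.
  have Ib : I b by apply: is_idealD => //; apply: is_idealMr.
  by apply: is_idealD => //; apply: is_idealMr.
exists d2, d1; rewrite !dotw rX rY sX sY -/x -/y -[RHS]eq1 /a /b /z; ring.
Qed.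

End StableRank.

(** * The product of two Siegel parabolic subgroups *)

Section Decomposition.
Variables (R : comPzRingType) (l : nat) (I : set R).
Hypothesis idI : is_ideal I.
Local Notation G := (spinGL R l).
Implicit Types (b c : 'I_l -> bool) (u v : 'cV[R]_l) (i j k n : 'I_l) (w : 'cV[R]_l).
Local Notation "''d_' i" := (basis R i) (at level 8, i at level 2, format "''d_' i").

Definition parabolic b : set G := mulg_set (levi_rel b I) (radical b I).

Lemma levi_rel_conj b g x : levi b g -> levi_rel b I x -> levi_rel b I (g * x * g^-1)%g.
Proof. by case: (levi_rel_normal b idI) => _ _; apply. Qed.

Lemma mem_parabolicl b x : levi_rel b I x -> parabolic b x.
Proof.
move=> bx; rewrite -[x]mulg1; apply: mem_mulg_set => //.
by case: (radical_subgroup b I).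
Qed.

Lemma mem_parabolicr b x : radical b I x -> parabolic b x.
Proof.
move=> bx; rewrite -[x]mul1g; apply: mem_mulg_set => //.
by case: (levi_rel_subgroup b idI).
Qed.

Lemma parabolic_subgroup b : is_subgroup (parabolic b).
Proof.
have [L1 LM LV] := levi_rel_subgroup b idI; have [U1 UM UV] := radical_subgroup b I.
have Lb := @levi_rel_sub _ _ b I idI.
split; first by rewrite -[1%g]mulg1; apply: mem_mulg_set.
  move=> _ _ [m Lm [u Uu <-]] [m' Lm' [u' Uu' <-]].
  have -> : (m * u * (m' * u') = (m * m') * ((m'^-1 * u * m') * u'))%g.
    by rewrite !mulgA mulgK.
  apply: mem_mulg_set; [exact: LM|apply: (UM)] => //.
  rewrite -{2}(invgK m'); apply: radical_conj idI _ Uu.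
  by apply: (Lb); apply: (LV).
move=> _ [m Lm [u Uu <-]].
have -> : ((m * u)^-1 = m^-1 * (m * u^-1 * m^-1))%g by rewrite invgM !mulgA mulVg mul1g.
apply: mem_mulg_set; first exact: LV.
by apply: radical_conj idI _ (UV _ Uu); exact: Lb.
Qed.

Lemma parabolic_conj b g x : levi b g -> parabolic b x -> parabolic b (g * x * g^-1)%g.
Proof.
move=> bg [m Lm [u Uu <-]].
have -> : (g * (m * u) * g^-1 = (g * m * g^-1) * (g * u * g^-1))%g.
  by rewrite !mulgA mulgVK.
by apply: mem_mulg_set; [exact: levi_rel_conj|exact: radical_conj].
Qed.

Lemma parabolic_conj_radical b g x :
  radical b setT g -> parabolic b x -> parabolic b (g * x * g^-1)%g.
Proof.
move=> bg [m Lm [u Uu <-]].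
have [L1 LM LV] := levi_rel_subgroup b idI; have [U1 UM UV] := radical_subgroup b I.
have [T1 TM TV] := radical_subgroup b [set: R].
have gu : (u * g^-1 = g^-1 * u)%g.
  by apply: radical_abelian (TV _ bg); apply: (radicalS (I := I)).
have -> : (g * (m * u) * g^-1 = m * ((m^-1 * g * m^-1^-1 * g^-1) * u))%g.
  by rewrite mulgA -(mulgA _ u) gu invgK !mulgA mulgV mul1g.
by apply: mem_mulg_set => //; apply: UM => //; apply: radical_comm => //; apply: LV.
Qed.

(** The roots involved are those lying in neither parabolic subgroup. *)
Definition corner b c : set G :=
  radical (negb_fun b) I `&` radical (negb_fun c) I.

Definition big_cell b c : set G :=
  mulg_set (mulg_set (parabolic c) (corner b c)) (parabolic b).

(** Only the roots e_i + e_n occur in such a transvection. *)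
Lemma flipped_evec (H : set G) n b w t : is_subgroup H ->
  (forall i, i != n ->
     H (transv (evec b 'd_i) ((w i 0 * t) *: evec b 'd_n))) ->
  w n 0 = 0 -> H (transv (evec b w) (t *: evec b 'd_n)).
Proof.
move=> sgH Hi wn; have [H1 _ _] := sgH.
rewrite -evecZ; apply: (transv_evec sgH) => i j ij.
have -> : (t *: 'd_n : 'cV[R]_l) j 0 = t * 'd_n j 0 by rewrite mxE.
have [->|jn] := eqVneq j n; last first.
  by rewrite basis0 1?eq_sym // !mulr0 scale0r transvx0 ?evec_sqr.
have [->|iN] := eqVneq i n; first by rewrite wn mul0r scale0r transvx0 ?evec_sqr.
by rewrite mxE !eqxx mulr1; exact: Hi.
Qed.

Lemma flipped_levi_evec n b c w t : flipped n b c -> w n 0 = 0 ->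
  levi c (transv (evec b w) (t *: evec b 'd_n)).
Proof.
move=> bc; apply: flipped_evec; first exact: levi_subgroup.
by move=> i ni; exact: flipped_levi bc ni.
Qed.

Lemma flipped_levi_rel_evec n b c w t : flipped n b c ->
  (forall i, I (w i 0 * t)) -> w n 0 = 0 ->
  levi_rel c I (transv (evec b w) (t *: evec b 'd_n)).
Proof.
move=> bc Iw; apply: flipped_evec; first exact: levi_rel_subgroup.
by move=> i ni; apply: flipped_levi_rel idI bc ni _.
Qed.

Lemma radical_sub_parabolic n b c : flipped n b c -> radical b I `<=` parabolic c.
Proof.
move=> bc x /(radical_split idI bc)[y [z [[cy _] [cz _] ->]]].
exact: mem_mulg_set.
Qed.

Lemma radical_sub_corner n b c x : flipped n b c -> radical (negb_fun b) I x ->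
  exists y z, [/\ levi_rel c I y, corner b c z & x = (y * z)%g].
Proof.
move=> bc /(radical_split idI (flipped_neg bc))[y [z [[cy _] [cz bz] ->]]].
by exists y, z; split; rewrite // -levi_rel_neg.
Qed.

Lemma radicalV b (J : set R) x : radical b J x -> radical b J x^-1%g.
Proof. by case: (radical_subgroup b J) => _ _; apply. Qed.

Lemma cornerC b c : corner b c = corner c b. Proof. exact: setIC. Qed.

Lemma cornerV b c x : corner b c x -> corner b c x^-1%g.
Proof. by case=> bx cx; split; apply: radicalV. Qed.

(** Passing to inverses, a corner element goes to the left of the Levi factor. *)
Lemma radical_sub_cornerr n b c x : flipped n b c -> radical (negb_fun c) I x ->
  exists z y, [/\ corner b c z, levi_rel b I y & x = (z * y)%g].
Proof.
move=> bc /radicalV/(radical_sub_corner (flipped_sym bc))[y [z [cy bz xE]]].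
exists z^-1%g, y^-1%g; split; first by apply: cornerV; rewrite cornerC.
  by case: (levi_rel_subgroup b idI) => _ _; apply.
by rewrite -invgM -xE invgK.
Qed.

(** A transvection depends only on the bivector of its vectors, which a base change
    of their plane multiplies by the determinant. *)
Lemma transv_det b u v (t p q r s : R) :
  transv (evec b (p *: u + q *: v)) (t *: evec b (r *: u + s *: v)) =
  transv (evec b u) ((t * (p * s - q * r)) *: evec b v).
Proof.
apply: unit_val_inj; rewrite !unit_transv; try by rewrite -evecZ; exact: evec_isotropic.
congr (1 + _); rewrite !evecD !evecZ scalerDr !scalerA mulrDl !mulrDr.
rewrite -!mulmxE -!scalemxAl -!scalemxAr !mulmxE !evec_sqr (evec_anti b v u).
rewrite !scaler0 add0r addr0 !scalerA scalerN -scalerBl; congr (_ *: _); ring.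
Qed.

Lemma colD u v i : (u + v) i 0 = u i 0 + v i 0. Proof. by rewrite mxE. Qed.
Lemma colZ (r : R) u i : (r *: u) i 0 = r * u i 0. Proof. by rewrite mxE. Qed.

(** Two columns of a matrix congruent to 1 modulo I span a plane: stable range makes
    their n-th coordinates unimodular, after which a base change of determinant
    one turns these coordinates into 0 and 1. *)
Lemma plane_reduction n j (y0 : 'cV[R]_l) (K K' : 'M[R]_l) : SR2 I ->
  j != n -> y0 n 0 = 1 -> y0 j 0 = 0 -> K' *m K = 1%:M ->
  mx_in I (K - 1%:M) -> mx_in I (K' - 1%:M) ->
  exists y X Z : 'cV[R]_l, [/\ y n 0 = 0 /\ (forall i, I (y i 0)),
    X n 0 = 0, Z n 0 = 0 & forall b (t : R),
    transv (evec b (K *m 'd_j + dot y (K *m 'd_j) *: 'd_n))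
      (t *: evec b (K *m y0 + dot y (K *m y0) *: 'd_n)) =
    transv (evec b X) (t *: evec b ('d_n + Z))].
Proof.
move=> sr jn y0n y0j K'K KI K'I; set X := K *m 'd_j; set Y := K *m y0.
have [y [yn Iy [c1 [d1 cd]]]] : exists y : 'cV[R]_l, [/\ y n 0 = 0, forall i, I (y i 0) &
    exists c1 d1 : R, c1 * (X n 0 + dot y X) + d1 * (Y n 0 + dot y Y) = 1].
  have KE (M : 'M[R]_l) (w : 'cV[R]_l) i : (M *m w) i 0 - w i 0 = ((M - 1%:M) *m w) i 0.
    by rewrite mulmxBl mul1mx [RHS]mxE; congr (_ + _); rewrite mxE.
  apply: (@frame_row_unimodular _ I idI _ n X Y (row j K')^T (row n K')^T sr).
  - by rewrite dot_row mulmxA K'K mul1mx mxE !eqxx.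
  - by rewrite dot_row mulmxA K'K mul1mx.
  - by rewrite dot_row mulmxA K'K mul1mx basis0.
  - by rewrite dot_row mulmxA K'K mul1mx.
  - by rewrite -[X n 0]subr0 -(basis0 R jn) KE; apply: (mx_in_mulr idI).
  - by rewrite -y0n KE; apply: (mx_in_mulr idI).
  - by have := K'I j n; rewrite !mxE (negPf jn) subr0; exact.
  - by have := K'I n n; rewrite !mxE eqxx; exact.
pose X1 := X + dot y X *: 'd_n; pose Y1 := Y + dot y Y *: 'd_n.
have X1n : X1 n 0 = X n 0 + dot y X by rewrite colD colZ [X in _ * X]mxE !eqxx mulr1.
have Y1n : Y1 n 0 = Y n 0 + dot y Y by rewrite colD colZ [X in _ * X]mxE !eqxx mulr1.
rewrite -X1n -Y1n in cd.
exists y, (Y1 n 0 *: X1 + - X1 n 0 *: Y1), (c1 *: X1 + d1 *: Y1 - 'd_n); split=> //.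
- by rewrite colD !colZ; ring.
- by rewrite colD colD !colZ cd !mxE !eqxx subrr.
move=> b t; rewrite (addrC 'd_n) subrK transv_det.
have -> : t * (Y1 n 0 * d1 - - X1 n 0 * c1) = t * (c1 * X1 n 0 + d1 * Y1 n 0) by ring.
by rewrite cd mulr1.
Qed.

(** The conjugate T(x, t y) of a negative root unipotent by the element h of the
    Levi subgroup is brought, by stable range and a base change of determinant
    one in the plane of x and y, to the form q T(x', t f_n) q^-1 with x' of zero
    n-th coordinate: the middle factor lies in the Levi subgroup of c, and q lies
    both in the Levi subgroup of b and in the opposite radical of c. The entries
    of q need not be in I, but q only enters the result through commutators with
    elements of the relative groups and through conjugates of such elements. *)
Lemma big_cell_transv n j b c (y0 : 'cV[R]_l) (t : R) (p sg u h : G) : SR2 I ->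
  flipped n b c -> j != n -> y0 n 0 = 1 -> y0 j 0 = 0 -> I t ->
  parabolic c p -> corner b c sg -> radical b I u -> levi_rel b I h ->
  big_cell b c (p * sg * u * h *
    transv (evec (negb_fun b) 'd_j) (t *: evec (negb_fun b) y0))%g.
Proof.
move=> sr bc jn y0n y0j It cp bcsg bu bh.
set B := negb_fun b; set C := negb_fun c.
have BC : flipped n B C := flipped_neg bc.
have cb := flipped_sym bc; have CB := flipped_sym BC.
have Bh : levi_rel B I h by rewrite levi_rel_neg.
have [K [K' [[KK' K'K hK] KI K'I]]] := levi_rel_acts idI Bh.
have [y [X [Z [[yn Iy] Xn Zn planeE]]]] := plane_reduction sr jn y0n y0j K'K KI K'I.
(* a adds the multiples of the other coordinates given by y to the n-th one, and
   q carries f_n to f_n + Z. *)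
pose a := transv (evec B 'd_n) (evec b y).
pose q := transv (evec B Z) (evec b 'd_n).
pose v := transv (evec B X) (t *: evec B 'd_n).
have fn : evec B 'd_n = evec c 'd_n by rewrite (evec_flipped_basis R cb).
have en : evec b 'd_n = evec C 'd_n by rewrite (evec_flipped_basis R bc).
have ca : radical c I a.
  rewrite /a fn (evec_flipped bc yn); apply: radical_evec => i k.
  by apply: is_idealMl => //; exact: Iy.
have ba : levi_rel b I a.
  rewrite /a fn (evec_flipped bc yn) -[evec c y]scale1r transv_swap;
    last exact: evec_isotropic.
  by apply: (flipped_levi_rel_evec cb) => // i; apply: is_idealMr => //; exact: Iy.
have Cq : radical C setT q.
  by rewrite /q en (evec_flipped BC Zn); apply: radical_evec.
have bq : levi b q.
  rewrite /q en (evec_flipped BC Zn) -levi_neg -[evec C 'd_n]scale1r.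
  exact: (flipped_levi_evec 1 CB).
have cv : levi_rel c I v.
  rewrite -levi_rel_neg; apply: (flipped_levi_rel_evec BC) => // i.
  exact: is_idealMl.
have aE w : act a (evec B w) = evec B (w + dot y w *: 'd_n).
  have iso : isotropic (evec B 'd_n) (evec b y).
    apply: isotropic_sym; apply: isotropic_dual; by rewrite dotC dot_basis.
  rewrite (@act_transv _ _ _ _ _ 0 (dot y w) iso) ?scale0r ?subr0 ?evecD ?evecZ //.
    by rewrite evec_anti addNr raddf0.
  by rewrite evec_dual.
have qE w : act q (evec B w) = evec B (w + w n 0 *: Z).
  have iso : isotropic (evec B Z) (evec b 'd_n).
    by apply: isotropic_sym; apply: isotropic_dual; rewrite dot_basis.
  rewrite (@act_transv _ _ _ _ _ 0 (w n 0) iso) ?scale0r ?subr0 ?evecD ?evecZ //.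
    by rewrite evec_anti addNr raddf0.
  by rewrite evec_dual dot_basis.
have tauE : (a * (h * transv (evec B 'd_j) (t *: evec B y0) * h^-1) * a^-1 =
    q * v * q^-1)%g.
  rewrite -evecZ [in RHS]transv_act; last by rewrite -evecZ; exact: evec_isotropic.
  rewrite [in LHS]transv_act; last exact: evec_isotropic.
  rewrite transv_act !hK; last exact: evec_isotropic.
  rewrite !actZ -scalemxAr evecZ actZ !aE !qE Xn scale0r addr0.
  by rewrite (_ : 'd_n n 0 = 1) ?scale1r ?planeE // mxE !eqxx.
set v0 := transv _ _ in tauE *.
clearbody a q v v0.
have La : levi b a by apply: levi_rel_sub ba.
have LV : levi b q^-1%g by case: (levi_subgroup R b) => _ _; apply.
(* The remaining factors are moved apart: those of the Levi subgroup of c to the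
   left, those of the parabolic subgroup of b to the right. *)
have [y1 [z1 [cy1 bcz1 aE1]]] : exists y1 z1,
    [/\ levi_rel c I y1, corner b c z1 & (a * sg * a^-1 = y1 * z1)%g].
  apply: (radical_sub_corner bc); apply: (radical_conj idI); first by rewrite levi_neg.
  by case: bcsg.
have [w1 [w2 [[cw1 _] [cw2 _] u2E]]] : exists w1 w2 : G,
    [/\ levi_rel c I w1 /\ radical b I w1,
    radical c I w2 /\ radical b I w2 & (q^-1 * (a * u * a^-1) * q = w1 * w2)%g].
  apply: (radical_split idI bc); rewrite -{2}(invgK q).
  by apply: (radical_conj idI LV); apply: (radical_conj idI La).
have [L1 LM LVc] := levi_rel_subgroup c idI.
have [m mE] : exists m : G, m = (w1 * v)%g by exists (w1 * v)%g.
have cm : levi_rel c I m by rewrite mE; apply: LM.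
have cmV := LVc _ cm.
have [s [k [bcs bk rhoE]]] : exists s k : G, [/\ corner b c s, levi_rel b I k &
    ((m^-1 * z1 * m) * (m^-1 * q * m * q^-1) = s * k)%g].
  apply: (radical_sub_cornerr bc); rewrite -/C.
  have CmV : levi_rel C I m^-1%g by rewrite levi_rel_neg.
  have [_ UM _] := radical_subgroup C I; apply: (UM).
    rewrite -{2}(invgK m); apply: (radical_conj idI); last by case: bcz1.
    exact: levi_rel_sub CmV.
  by rewrite -{2}(invgK m); apply: radical_comm.
have [w2' w2E] : exists w2' : G, w2' = (v^-1 * w2 * v)%g by exists (v^-1 * w2 * v)%g.
have bw2' : parabolic b w2'.
  apply: (radical_sub_parabolic cb); rewrite w2E -{2}(invgK v).
  by apply: (radical_conj idI) cw2; apply: (levi_rel_sub idI); exact: LVc.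
have [_ PMb _] := parabolic_subgroup b; have [_ PMc PVc] := parabolic_subgroup c.
have -> : (p * sg * u * h * v0 =
    (p * a^-1 * y1 * m) * s * (k * (q * w2' * q^-1) * (a * h)))%g.
  have skE : (m * s * k = z1 * q * m * q^-1)%g.
    by rewrite -mulgA -rhoE !mulgA mulgV mul1g mulgK.
  have mwE : (m * w2' = q^-1 * a * u * a^-1 * q * v)%g.
    by rewrite mE w2E !mulgA mulgK -u2E !mulgA.
  have hvE : (h * v0 = a^-1 * q * v * q^-1 * a * h)%g.
    transitivity (a^-1 * (q * v * q^-1) * a * h)%g; last by rewrite !mulgA.
    by rewrite -tauE !mulgA mulVg mul1g !mulgVK.
  transitivity (p * a^-1 * y1 * (m * s * k) * q * w2' * q^-1 * a * h)%g; last first.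
    by rewrite !mulgA.
  rewrite skE.
  transitivity (p * a^-1 * (y1 * z1) * q * (m * w2') * q^-1 * a * h)%g; last first.
    by rewrite !mulgA mulgVK.
  by rewrite mwE -aE1 -(mulgA _ h) hvE !mulgA !(mulgK, mulgVK).
apply: mem_mulg_set; last first.
  apply: (PMb); first apply: (PMb).
  - exact: mem_parabolicl.
  - exact: parabolic_conj.
  - by apply: mem_parabolicl; case: (levi_rel_subgroup b idI) => _ + _; apply.
apply: mem_mulg_set => //; apply: (PMc); last exact: mem_parabolicl.
apply: (PMc); last exact: mem_parabolicl.
by apply: (PMc) => //; apply: (PVc); apply: mem_parabolicr.
Qed.

End Decomposition.

(** * The relative Dennis-Vaserstein decomposition *)

Section Stability.
Variables (R : comPzRingType) (l : nat) (I : set R).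
Hypotheses (idI : is_ideal I) (sr : SR2 I).
Local Notation G := (spinGL R l).
Implicit Types (b c : 'I_l -> bool) (i j n : 'I_l) (x y g : G).
Local Notation "''d_' i" := (basis R i) (at level 8, i at level 2, format "''d_' i").
Local Notation big_cell := (big_cell I).
Local Notation parabolic := (parabolic I).

Lemma big_cell_rightM b c x y : big_cell b c x -> parabolic b y -> big_cell b c (x * y)%g.
Proof.
move=> [z Yz [w bw <-]] by_; rewrite -mulgA; apply: mem_mulg_set => //.
by case: (parabolic_subgroup idI b) => _ + _; apply.
Qed.

Lemma big_cellV b c x : big_cell b c x -> big_cell c b x^-1%g.
Proof.
move=> [_ [p cp [s bcs <-]] [q bq <-]]; rewrite !invgM mulgA.
have [_ _ cV] := parabolic_subgroup idI c; have [_ _ bV] := parabolic_subgroup idI b.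
apply: mem_mulg_set; last exact: cV.
apply: mem_mulg_set; first exact: bV.
by apply: cornerV; rewrite cornerC.
Qed.

Lemma mem_big_cell b c x : parabolic c x -> big_cell b c x.
Proof.
have [b1 _ _] := parabolic_subgroup idI b.
have [C1 _ _] := radical_subgroup (negb_fun c) I.
have [B1 _ _] := radical_subgroup (negb_fun b) I.
move=> cx; rewrite -[x]mulg1 -[x]mulg1; apply: mem_mulg_set => //.
exact: mem_mulg_set.
Qed.

Lemma big_cell1 b c : big_cell b c 1%g.
Proof. by apply: mem_big_cell; case: (parabolic_subgroup idI c). Qed.

Lemma big_cell_corank_one n j b c (y0 : 'cV[R]_l) (t : R) x : flipped n b c ->
  j != n -> y0 n 0 = 1 -> y0 j 0 = 0 -> I t -> big_cell b c x ->
  big_cell b c (x * transv (evec (negb_fun b) 'd_j) (t *: evec (negb_fun b) y0))%g.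
Proof.
move=> bc jn y0n y0j It [_ [p cp [s bcs <-]] [q bq <-]].
have [m [u [bm bu qE]]] : exists m u : G,
    [/\ levi_rel b I m, radical b I u & q = (u * m)%g].
  case: bq => m bm [u bu <-]; exists m, (m * u * m^-1)%g; split; rewrite ?mulgVK //.
  by apply: (radical_conj idI) bu; exact: levi_rel_sub bm.
rewrite qE mulgA; exact: (big_cell_transv idI sr bc jn).
Qed.

(** The previous lemma needs a second vector of n-th coordinate 1: for i, j other
    than n, a transvection of f_i and f_j is the product of one of f_i and
    f_n + f_j by one of f_i and - f_n. *)
Lemma big_cell_right_radical n b c :
  flipped n b c -> radical (negb_fun b) I `<=` right_stabiliser (big_cell b c).
Proof.
move=> bc; set B := negb_fun b.
suff gens i j t x : I t -> big_cell b c x ->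
    big_cell b c (x * transv (evec B 'd_i) (t *: evec B 'd_j))%g.
  apply: generated_min; first exact: right_stabiliser_subgroup.
  move=> _ [i [j [t [It ->]]]] x Yx; split; first exact: gens.
  rewrite transvV -?scaleNr; last by rewrite -evecZ; exact: evec_isotropic.
  by apply: gens => //; exact: is_idealN.
have dn : 'd_n n 0 = 1 by rewrite mxE !eqxx.
have atn k s z : k != n -> I s -> big_cell b c z ->
    big_cell b c (z * transv (evec B 'd_k) (s *: evec B 'd_n))%g.
  by move=> kn Is; apply: (big_cell_corank_one bc); rewrite // basis0 // eq_sym.
move=> It Yx; have [->|ij] := eqVneq i j.
  by rewrite transvxx ?evec_sqr ?mulg1.
have [jn|jn] := eqVneq j n; first by subst j; exact: atn.
have [iN|iN] := eqVneq i n.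
  subst i; rewrite transv_swap; last exact: evec_isotropic.
  by apply: atn => //; exact: is_idealN.
have -> : transv (evec B 'd_i) (t *: evec B 'd_j) =
    (transv (evec B 'd_i) (t *: evec B ('d_n + 'd_j)) *
     transv (evec B 'd_i) (- t *: evec B 'd_n))%g.
  rewrite -!evecZ -transvDr; try exact: evec_isotropic.
  by rewrite -evecD scalerDr scaleNr addrAC subrr add0r.
rewrite mulgA; apply: atn => //; first exact: is_idealN.
apply: (big_cell_corank_one bc iN) => //.
  by rewrite mxE dn basis0 // addr0.
by rewrite mxE !basis0 ?addr0 // eq_sym.
Qed.

(** In g (p s q) g^-1 the conjugates of s and q are absorbed on the right, so only
    that of p matters. A generator g of the Levi subgroup of b lies in the Levi
    subgroup of c, in the radical of c or in the opposite radical. The first two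
    normalise the parabolic subgroup of c. In the third case write p = m u: the
    commutator of m and g is in the opposite radical over I, and u lies in the
    parabolic subgroup of b, which g normalises. *)
Lemma big_cell_conj_levi n b c :
  flipped n b c -> levi b `<=` conj_stabiliser (big_cell b c).
Proof.
move=> bc; set B := negb_fun b; set C := negb_fun c; set Y := big_cell b c.
have cb := flipped_sym bc; have BC : flipped n B C := flipped_neg bc.
have CB := flipped_sym BC.
have Lc := levi_rel_subgroup c idI; have [_ _ LcV] := Lc.
suff gens i j t x : i != j -> Y x ->
    Y (transv (evec b 'd_i) (t *: evec B 'd_j) * x *
       (transv (evec b 'd_i) (t *: evec B 'd_j))^-1)%g.
  rewrite leviE; apply: generated_min; first exact: conj_stabiliser_subgroup.
  move=> _ [i [j [t [ij _ ->]]]] x Yx; rewrite gammaE gammaNE -/B.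
  split; first exact: gens.
  have iso : isotropic (evec b 'd_i) (t *: evec B 'd_j).
    by rewrite -evecZ; apply: isotropic_dual; rewrite dot_basis !mxE (negPf ij) mulr0.
  by rewrite -{2}(invgK (transv _ _)) transvV // -scaleNr; apply: gens.
move=> ij; set g := transv _ _.
have bg : levi b g by exact: mem_levi.
have Yrad y z : Y y -> radical B I z -> Y (y * z)%g.
  by move=> Yy Bz; have [] := big_cell_right_radical bc Bz Yy.
suff Yp p : parabolic c p -> Y (g * p * g^-1)%g.
  move=> [_ [p cp [s [Bs _] <-]] [q bq <-]].
  have -> : (g * (p * s * q) * g^-1 =
      (g * p * g^-1) * (g * s * g^-1) * (g * q * g^-1))%g.
    by rewrite !mulgA !mulgVK.
  apply: big_cell_rightM; last exact: parabolic_conj.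
  apply: Yrad; first exact: Yp.
  by apply: (radical_conj idI) Bs; rewrite levi_neg.
have [jn|jn] := eqVneq j n.
  move=> cp; apply: mem_big_cell; apply: (parabolic_conj_radical idI) cp.
  rewrite /g jn (evec_flipped bc) -?(evec_flipped_basis R cb);
    last by rewrite basis0 // -jn.
  exact: mem_radical.
have [iN|iN] := eqVneq i n; last first.
  move=> cp; apply: mem_big_cell; apply: (parabolic_conj idI) cp.
  rewrite /g (evec_flipped bc) ?basis0 // (evec_flipped BC) ?basis0 //.
  exact: mem_levi.
move=> [m cm [u cu <-]].
have Cg : radical C setT g.
  rewrite /g iN (evec_flipped_basis R bc) (evec_flipped BC) ?basis0 //.
  exact: mem_radical.
have -> : (g * (m * u) * g^-1 = m * (m^-1 * g * m^-1^-1 * g^-1) * (g * u * g^-1))%g.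
  by rewrite invgK !mulgA mulgV mul1g !mulgVK.
apply: big_cell_rightM; last first.
  by apply: (parabolic_conj idI bg); exact: (radical_sub_parabolic idI cb).
have : radical C I (m^-1 * g * m^-1^-1 * g^-1)%g.
  by apply: (radical_comm idI) Cg; rewrite levi_rel_neg; exact: LcV.
move=> /(radical_sub_cornerr idI bc)[z [y [bcz by_ ->]]].
rewrite mulgA; apply: mem_mulg_set; last exact: mem_parabolicl.
by apply: mem_mulg_set => //; exact: mem_parabolicl.
Qed.

(** Inversion exchanges the big cells of (b, c) and (c, b). *)
Lemma conj_stabiliser_flip n b c : flipped n b c ->
  levi c `<=` conj_stabiliser (big_cell b c).
Proof.
move=> bc; apply: subset_trans (big_cell_conj_levi (flipped_sym bc)) _.
apply: conj_stabiliserV => y; split; first exact: big_cellV.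
by move=> /big_cellV; rewrite invgK.
Qed.

(** The roots e_i + e_j with i, j other than n are sums of the root e_i + e_n of one
    Levi subgroup and the root e_j - e_n of the other. *)
Lemma transv_levi_generated (H : set G) n b c i j (t : R) : is_subgroup H ->
  flipped n b c -> levi b `<=` H -> levi c `<=` H ->
  H (transv (evec b 'd_i) (t *: evec b 'd_j)).
Proof.
move=> [H1 HM HV] bc bH cH; have [->|ij] := eqVneq i j; first by rewrite transvxx ?evec_sqr.
have atn k s : k != n -> H (transv (evec b 'd_k) (s *: evec b 'd_n)).
  by move=> kn; apply: (cH); exact: flipped_levi bc kn.
have [jn|jn] := eqVneq j n; first by subst j; exact: atn.
have [iN|iN] := eqVneq i n.
  by subst i; rewrite transv_swap; [exact: atn|exact: evec_isotropic].
pose g := transv (evec b 'd_j) (1 *: evec (negb_fun b) 'd_n).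
have bg : H g by apply: (bH); exact: mem_levi.
have -> : transv (evec b 'd_i) (t *: evec b 'd_j) =
    ((transv (evec b 'd_i) (t *: evec b 'd_n))^-1 *
     (g * transv (evec b 'd_i) (t *: evec b 'd_n) * g^-1))%g.
  rewrite -!evecZ [in RHS]transv_act ?act_levi_gen //; try exact: evec_isotropic.
  rewrite basis0 // mulr0 scale0r addr0 mul1r [(t *: 'd_n) n 0]mxE [X in t * X]mxE.
  rewrite !eqxx mulr1 evecD transvDr; try exact: evec_isotropic.
  by rewrite !evecZ mulKg.
apply: (HM); first by apply: (HV); exact: atn.
by apply: (HM); [apply: (HM) => //; exact: atn | exact: HV].
Qed.

Lemma Epin_min (H : set G) n b c : is_subgroup H -> flipped n b c ->
  levi b `<=` H -> levi c `<=` H -> Epin R l `<=` H.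
Proof.
move=> sgH bc bH cH; apply: generated_min => // _ [r [t [_ ->]]].
have [i [j [ij [->|->|[s [_ ->]]]]]] := root_eltP b r t.
- exact: (transv_levi_generated _ _ _ sgH bc).
- by apply: (transv_levi_generated _ _ _ sgH (flipped_neg bc)); rewrite levi_neg.
- by apply: bH; apply: mem_levi.
Qed.

(** A relative Dennis-Vaserstein decomposition for the two Siegel parabolic
    subgroups. *)
Theorem Epin_rel_big_cell n b c : flipped n b c -> Epin_rel l I `<=` big_cell b c.
Proof.
move=> bc; have sgE : is_subgroup (Epin R l) by exact: generated_subgroup.
apply: normal_closure_stabiliser => //.
- exact: big_cell1.
- apply: (Epin_min (conj_stabiliser_subgroup _) bc).
    exact: big_cell_conj_levi bc.
  exact: conj_stabiliser_flip bc.
- apply: generated_min => // _ [r [t [_ _ ->]]]; apply: mem_generated.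
  by exists r, t; rewrite inE.
apply: generated_min; first exact: right_stabiliser_subgroup.
have Yb : parabolic b `<=` right_stabiliser (big_cell b c).
  move=> x bx y Yy; split; apply: big_cell_rightM => //.
  by case: (parabolic_subgroup idI b) => _ _; apply.
move=> _ [r [t [_ It ->]]].
have [i [j [ij [->|->|[s [st ->]]]]]] := root_eltP b r t.
- by apply: Yb; apply: (mem_parabolicr idI); apply: mem_radical.
- by apply: (big_cell_right_radical bc); exact: mem_radical.
- apply: Yb; apply: mem_parabolicl; apply: mem_levi_rel => //.
  by case: st => ->; last exact: is_idealN.
Qed.

End Stability.

(** * Two regularly embedded subgroups cover a radical *)

Section TwoFactors.
Variables (R : comPzRingType) (l : nat) (I : set R).
Hypotheses (idI : is_ideal I).
Local Notation G := (spinGL R l).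
Implicit Types (b : 'I_l -> bool) (u v w : 'cV[R]_l) (i j n : 'I_l).

(** For such N and N' one has N N' = 0, hence (1 + N) (1 + N') = 1 + N + N'. *)
Lemma levi_acts_add b (P : pred 'I_l) (N : 'M[R]_l) :
  (forall i k, ~~ (P k && ~~ P i) -> N i k = 0) ->
  exists2 g, levi b g & acts_by b g (1%:M + N).
Proof.
pose Q (M : 'M[R]_l) := (forall i k, ~~ (P k && ~~ P i) -> M i k = 0) /\
  exists2 g, levi b g & acts_by b g (1%:M + M).
have [L1 LM _] := levi_subgroup R b.
move=> NP; suff [] : Q N by [].
rewrite (matrix_sum_delta N).
have Q0 : Q 0.
  split=> [i k _|]; first by rewrite mxE.
  by exists 1%g => // u; rewrite addr0 mul1mx act1.
have QD (M M' : 'M[R]_l) : Q M -> Q M' -> Q (M + M').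
  move=> [MP [g bg gM]] [MP' [h bh hM]]; split.
    by move=> i k ik; rewrite mxE MP // MP' // addr0.
  exists (g * h)%g; first exact: LM.
  move=> u; rewrite actM hM gM mulmxA; congr (evec _ (_ *m _)).
  have MM : M *m M' = 0.
    apply/matrixP => i k; rewrite mxE [RHS]mxE big1 // => j _.
    case Pj : (P j); first by rewrite MP' ?mulr0 // Pj andbF.
    by rewrite MP ?mul0r // Pj.
  by rewrite mulmxDl mul1mx mulmxDr mulmx1 MM addr0 -addrA (addrC M').
apply: (big_ind Q Q0 QD) => i _; apply: (big_ind Q Q0 QD) => k _.
case ik : (P k && ~~ P i); last by rewrite NP ?ik // scale0r.
have iNk : i != k by apply: contraTneq ik => ->; rewrite andbN.
split=> [i' k'|].
  rewrite !mxE; case: eqP => [->|_]; case: eqP => [->|_]; rewrite ?mulr0 //.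
  by rewrite ik.
exists (transv (evec b (basis R i)) (N i k *: evec (negb_fun b) (basis R k))).
  exact: mem_levi.
by have [] := acts_inv_gen b (N i k) iNk.
Qed.

(** Indices past the end give 0, so that shifts of indices need no side condition. *)
Definition nbasis m : 'cV[R]_l := \col_i (i == m :> nat)%:R.

Lemma nbasis_ord i : nbasis i = basis R i.
Proof. by apply/matrixP => k z; rewrite ord1 !mxE andbT. Qed.

Lemma nbasis_out m : (l <= m)%N -> nbasis m = 0.
Proof. by move=> lm; apply/matrixP => i z; rewrite !mxE ltn_eqF // (leq_trans _ lm). Qed.

Lemma mulmx_nbasis (N : 'M[R]_l) m (mv : (m < l)%N) i :
  (N *m nbasis m) i 0 = N i (Ordinal mv).
Proof.
rewrite mxE (bigD1 (Ordinal mv)) //= big1 ?addr0; first by rewrite mxE eqxx mulr1.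
by move=> k km; rewrite mxE (_ : (k == m :> nat) = false) ?mulr0 //; apply/negbTE.
Qed.

(** This g moves both the span of the even basis vectors and that of the odd ones;
    it is the product of a map e_m -> e_m + e_(m+3), m even, by a map
    e_m -> e_m + e_(m-1), m odd. The shifts are chosen for the relations in the
    proof of [radical_sub_wedges] to telescope. *)
Lemma levi_mixing b : exists2 g, levi b g &
  (forall m, ~~ odd m -> act g (evec b (nbasis m)) = evec b (nbasis m + nbasis (m + 3))) /\
  (forall m, odd m -> (m < l)%N -> act g (evec b (nbasis m)) =
      evec b (nbasis m.-1 + (nbasis m + nbasis (m + 2)))).
Proof.
pose N1 : 'M[R]_l := \matrix_(i, k) (~~ odd k && (i == k + 3 :> nat)%N)%:R.
pose N2 : 'M[R]_l := \matrix_(i, k) (odd k && (i.+1 == k :> nat)%N)%:R.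
have [|g1 bg1 gE1] := @levi_acts_add b (fun k => ~~ odd k) N1.
  move=> i k; rewrite mxE negbK; case: eqP => [->|_]; last by rewrite andbF.
  by rewrite oddD addbT; case: (odd k).
have [|g2 bg2 gE2] := @levi_acts_add b (fun k => odd k) N2.
  move=> i k; rewrite mxE; case: eqP => [<-|_]; last by rewrite andbF.
  by rewrite /=; case: (odd i).
have NE1 m : N1 *m nbasis m = if odd m then 0 else nbasis (m + 3).
  case: (ltnP m l) => ml; last first.
    by rewrite !nbasis_out ?mulmx0 ?(leq_trans ml) ?leq_addr // if_same.
  apply/matrixP => i z; rewrite ord1 mulmx_nbasis // mxE /=.
  by case: (odd m); rewrite /= mxE.
have NE2 m : (m < l)%N -> N2 *m nbasis m = if odd m then nbasis m.-1 else 0.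
  move=> ml; apply/matrixP => i z; rewrite ord1 mulmx_nbasis // mxE /=.
  by case om : (odd m); rewrite /= mxE //; case: m om {ml}.
exists (g1 * g2)%g; first by have [_ + _] := levi_subgroup R b; apply.
split=> m om.
  rewrite actM gE2; case: (ltnP m l) => ml; last first.
    by rewrite !nbasis_out ?mulmx0 ?(leq_trans ml) ?leq_addr // gE1 mulmx0 addr0.
  by rewrite mulmxDl mul1mx NE2 // (negPf om) addr0 gE1 mulmxDl mul1mx NE1 (negPf om).
move=> ml; rewrite actM gE2 mulmxDl mul1mx NE2 // om gE1 mulmxDl mul1mx.
rewrite mulmxDr !NE1 om add0r; case: m om ml => //= m om ml.
rewrite (negPf om) (_ : (m.+1 + 2 = m + 3)%N); last lia.
by rewrite -addrA addrCA.
Qed.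

(** Modulo a subgroup W containing the transvections of an even and an odd vector,
    and those of their images under the element g of [levi_mixing], the whole
    radical becomes trivial. *)
Section Wedge.
Variables (b : 'I_l -> bool) (W : set G).
Hypothesis sgW : is_subgroup W.

(** The exponential of the bivector of u and v scaled by t, additive in u and v. *)
Definition wedge (t : R) u v : G := transv (evec b u) (t *: evec b v).

Lemma wedge_radical t u v : radical b setT (wedge t u v).
Proof. by rewrite /wedge -evecZ; apply: radical_evec. Qed.

Lemma wedgeC t u v t' u' v' :
  (wedge t u v * wedge t' u' v' = wedge t' u' v' * wedge t u v)%g.
Proof. exact: radical_abelian (wedge_radical t u v) (wedge_radical t' u' v'). Qed.

Lemma wedgeDr t u v w : wedge t u (v + w) = (wedge t u v * wedge t u w)%g.
Proof.
by rewrite /wedge evecD scalerDr -!evecZ transvDr //; exact: evec_isotropic.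
Qed.

Lemma wedgeDl t u v w : wedge t (u + v) w = (wedge t u w * wedge t v w)%g.
Proof. by rewrite /wedge evecD -!evecZ transvDl //; exact: evec_isotropic. Qed.

Lemma wedgeV t u v : (wedge t u v)^-1%g = wedge t v u.
Proof.
rewrite /wedge transvV; last by rewrite -evecZ; exact: evec_isotropic.
by rewrite -scaleNr transv_swap ?opprK //; exact: evec_isotropic.
Qed.

Lemma wedgexx t u : wedge t u u = 1%g.
Proof. exact/transvxx/evec_sqr. Qed.

Lemma wedge0r t u : wedge t u 0 = 1%g.
Proof. by apply: (mulgI (wedge t u 0)); rewrite -wedgeDr addr0 mulg1. Qed.

Lemma wedge0l t u : wedge t 0 u = 1%g.
Proof. by rewrite -wedgeV wedge0r invg1. Qed.

Let cancelW x y : W x -> W (x * y)%g -> W y.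
Proof.
have [_ WM WV] := sgW; move=> Wx Wxy.
by rewrite -(mulKg x y); apply: WM => //; exact: WV.
Qed.

Local Notation E i := (nbasis i.*2).
Local Notation F i := (nbasis i.*2.+1).

Hypothesis WA : forall (i j : nat) t, I t -> W (wedge t (E i) (F j)).
Hypothesis WB : forall (i j : nat) t, I t -> (j.*2.+1 < l)%N ->
  W (wedge t (E i + F i.+1) (E j + (F j + F j.+1))).

(* Modulo W, the wedge of E i and E j is that of F j + F (j + 1) and F (i + 1). *)
Let WEF (i j : nat) t : I t -> (j.*2.+1 < l)%N ->
  W (wedge t (E i) (E j) * wedge t (F i.+1) (F j + F j.+1))%g.
Proof.
have [_ WM WV] := sgW; move=> It jl; have := WB i It jl; set X := F j + F j.+1.
rewrite wedgeDl !(wedgeDr t _ (E j) X) (wedgeC t (E i) (E j) t (E i)) -!mulgA.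
rewrite (mulgA (wedge t (E i) (E j)) (wedge t _ (E j))).
rewrite (wedgeC t (E i) (E j) t _ (E j)) -mulgA.
move=> H; apply: (cancelW _ (cancelW _ H)); last by rewrite wedgeDr; apply: WM; exact: WA.
by rewrite -wedgeV; apply: WV; exact: WA.
Qed.

(* By WEF for (j, i) and for (i, j), the wedge of F i and F (j + 1) is that of
   F (i + 1) and F j modulo W: the difference of the indices drops by two, down
   to 0, or to 1, where WEF for (i, i) applies. *)
Let WFF (d i : nat) t : I t -> W (wedge t (F i) (F (i + d)%N)).
Proof.
have [W1 WM WV] := sgW.
have [n] := ubnP d; elim: n => // n IHn in d i t *; rewrite ltnS => dn It.
have [lo|hi] := leqP l (i + d).*2.+1; first by rewrite (nbasis_out lo) wedge0r.
case: d => [|[|d]] in dn hi *; first by rewrite addn0 wedgexx.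
  have il : (i.*2.+1 < l)%N by lia.
  have := WEF i It il; rewrite wedgexx mul1g wedgeDr wedgexx mulg1 => H.
  by rewrite addn1 -wedgeV; exact: WV.
have il : (i.*2.+1 < l)%N by lia.
set j := (i + d.+1)%N; have jl : (j.*2.+1 < l)%N by rewrite /j; lia.
have -> : (i + d.+2 = j.+1)%N by rewrite /j; lia.
have FF : W (wedge t (F i.+1) (F j)).
  have -> : j = (i.+1 + d)%N by rewrite /j; lia.
  by apply: IHn => //; lia.
have := WM _ _ (WEF i It jl) (WEF j It il).
set a := wedge t (E i) (E j); rewrite -(wedgeV t (E i)) -/a.
rewrite (wedgeDr t _ (F j)) (wedgeDr t _ (F i)).
set x := wedge t (F i.+1) (F j); set y := wedge t (F i.+1) (F j.+1).
rewrite -(wedgeV t (F i.+1) (F j.+1)) -/y -(wedgeV t (F i)).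
set z := wedge t (F i) _.
have ax : (a * x = x * a)%g by exact: wedgeC.
have ay : (a * y = y * a)%g by exact: wedgeC.
have zy : (z * y = y * z)%g by exact: wedgeC.
have -> : (a * (x * y) * (a^-1 * (z^-1 * y^-1)) = x * z^-1)%g.
  by rewrite -[(z^-1 * y^-1)%g]invgM -zy invgM !mulgA ax -(mulgA x a) ay !mulgA !mulgK.
by move=> /(cancelW FF)/WV; rewrite invgK.
Qed.

Let WF (i j : nat) t : I t -> W (wedge t (F i) (F j)).
Proof.
move=> It; have [ij|/ltnW ij] := leqP i j.
  by rewrite -(subnKC ij); exact: WFF.
have [_ _ WV] := sgW; rewrite -wedgeV -(subnKC ij); apply: WV; exact: WFF.
Qed.

Let WE (i j : nat) t : I t -> W (wedge t (E i) (E j)).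
Proof.
have [W1 WM WV] := sgW.
have low (p q : nat) : I t -> (q.*2.+1 < l)%N -> W (wedge t (E p) (E q)).
  move=> It ql; have := WEF p It ql; rewrite wedgeC => H; apply: (cancelW _ H).
  by rewrite wedgeDr; apply: WM; exact: WF.
move=> It; have [jl|jl] := ltnP j.*2.+1 l; first exact: low.
have [il|il] := ltnP i.*2.+1 l; first by rewrite -wedgeV; apply: WV; exact: low.
have [->|ij] := eqVneq i j; first by rewrite wedgexx.
have [lo|lo] := leqP l i.*2; first by rewrite nbasis_out ?wedge0l.
by rewrite (@nbasis_out j.*2) ?wedge0r //; lia.
Qed.

Lemma radical_sub_wedges : radical b I `<=` W.
Proof.
have [_ _ WV] := sgW.
apply: generated_min => // _ [i [j [t [It ->]]]].
rewrite -!nbasis_ord -/(wedge t _ _) -[i : nat]odd_double_half -[j : nat]odd_double_half.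
case: (odd i); case: (odd j); rewrite ?add1n ?add0n.
- exact: WF.
- by rewrite -wedgeV; apply: WV; exact: WA.
- exact: WA.
- exact: WE.
Qed.

End Wedge.

(** The radical of b meets the Levi subgroup of c, where the signs of the odd indices
    are changed, in the wedges of an even and an odd vector; conjugating by g
    supplies the missing ones. *)
Lemma radical_sub_two b : exists g c, levi b g /\
  radical b I `<=` mulg_set (levi_rel c I) (conjg_set g (levi_rel c I)).
Proof.
have [g bg [gE gO]] := levi_mixing b.
pose c i := b i (+) odd i; exists g, c; split=> //.
have sgL := levi_rel_subgroup c idI; have [L1 LM LV] := sgL.
have sgJ : is_subgroup (conjg_set g (levi_rel c I)).
  split; first by exists 1%g => //; rewrite mulg1 mulgV.
    move=> _ _ [x cx <-] [y cy <-]; exists (x * y)%g; first exact: LM.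
    by rewrite !mulgA mulgVK.
  move=> _ [x cx <-]; exists x^-1%g; first exact: LV.
  by rewrite !invgM invgK mulgA.
pose U : set G := radical b setT.
have sg1 := subgroupI sgL (radical_subgroup b setT).
have sg2 := subgroupI sgJ (radical_subgroup b setT).
pose W := mulg_set (levi_rel c I `&` U) (conjg_set g (levi_rel c I) `&` U).
have sgW : is_subgroup W.
  by apply: (mulg_set_subgroup sg1 sg2) => x y [_ xU] [_ yU]; exact: radical_abelian xU yU.
suff sub : radical b I `<=` W.
  by apply: subset_trans sub _; apply: mulg_setS => x [].
have cEF (m k : nat) t : ~~ odd m -> odd k -> I t ->
    levi_rel c I (wedge b t (nbasis m) (nbasis k)).
  move=> om ok It; have [lm|lm] := leqP l m; first by rewrite nbasis_out ?wedge0l.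
  have [lk|lk] := leqP l k; first by rewrite (nbasis_out lk) wedge0r.
  rewrite -[m]/(nat_of_ord (Ordinal lm)) -[k]/(nat_of_ord (Ordinal lk)) !nbasis_ord.
  have bE : evec b (basis R (Ordinal lm)) = evec c (basis R (Ordinal lm)).
    by rewrite !evec_basis /c /= (negPf om) addbF.
  have bO : evec b (basis R (Ordinal lk)) = evec (negb_fun c) (basis R (Ordinal lk)).
    by rewrite !evec_basis /c /negb_fun /= ok addbT negbK.
  rewrite /wedge bE bO; apply: mem_levi_rel => //; rewrite -val_eqE /=.
  by apply: contraNneq om => ->.
have [[one1 _ _] [one2 _ _]] := (sg1, sg2).
apply: (radical_sub_wedges sgW).
- move=> i j t It; rewrite -[wedge _ _ _ _]mulg1; apply: mem_mulg_set => //.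
  by split; [apply: cEF; rewrite //= odd_double|exact: wedge_radical].
move=> i j t It jl; rewrite -[wedge _ _ _ _]mul1g; apply: mem_mulg_set => //.
split; last exact: wedge_radical.
exists (wedge b t (nbasis i.*2) (nbasis j.*2.+1)).
  by apply: cEF; rewrite //= odd_double.
rewrite /wedge -evecZ transv_act; last exact: evec_isotropic.
rewrite evecZ actZ gE ?odd_double // gO //= ?odd_double //.
by rewrite addn3 addn2 doubleS.
Qed.

End TwoFactors.

(** * Subsystems of type A, and the factorisation *)

Section TypeA.
Variable l : nat.
Implicit Types (b : 'I_l -> bool) (i j k : 'I_l) (u v : 'rV[rat]_l).

Local Notation delta i := (delta_mx 0 i : 'rV[rat]_l).

(** The sign change carrying the root e_i - e_j to the root s_i e_i - s_j e_j. *)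
Definition sign_mx b : 'M[rat]_l := diag_mx (\row_i (-1) ^+ b i).

Lemma delta_sign b i : delta i *m sign_mx b = eps (i, b i).
Proof.
apply/rowP => j; rewrite mul_mx_diag /eps !mxE /= mulrC.
by case: (eqVneq j i) => [->|_] //; rewrite !mulr0.
Qed.

Lemma sign_mx_sqr b : sign_mx b *m sign_mx b = 1%:M.
Proof.
apply/matrixP => i j; rewrite mul_mx_diag !mxE.
case: eqVneq => [<-|_]; last by rewrite mulr0n mul0r.
by rewrite mulr1n -signr_addb addbb.
Qed.

Lemma dotv_sign b u v : dotv (u *m sign_mx b) (v *m sign_mx b) = dotv u v.
Proof.
rewrite /dotv trmx_mul tr_diag_mx mulmxA -(mulmxA u).
by rewrite -/(sign_mx b) sign_mx_sqr mulmx1.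
Qed.

Lemma cartan_sign b u v : cartan (u *m sign_mx b) (v *m sign_mx b) = cartan u v.
Proof. by rewrite /cartan !dotv_sign. Qed.

Lemma eps_opp i (s : bool) : eps (i, ~~ s) = - eps (i, s).
Proof. by rewrite /eps /= signrN scaleNr. Qed.

Lemma Aroots_stdA b :
  [set v *m sign_mx b | v in @stdA l] = [set root_vec r | r in [set` Aroots b]].
Proof.
apply/seteqP; split=> [_ [_ [i [j [ij ->]]] <-]|_ [r rb <-]].
  rewrite mulmxBl !delta_sign -eps_opp.
  have /orP[lt|lt] : (i < j)%N || (j < i)%N by rewrite -neq_ltn.
    exists (exist _ ((i, b i), (j, ~~ b j)) lt) => //.
    by rewrite /= inE /= eqxx; case: (b j).
  exists (exist _ ((j, ~~ b j), (i, b i)) lt); last by rewrite /root_vec /= addrC.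
  by rewrite /= inE /= eqxx; case: (b j).
case: r rb => -[[i s] [j s']] /= ij; rewrite /root_vec /= inE /= => rb.
have {}ij : i != j by apply: contraTneq ij => ->; rewrite ltnn.
have [si|si] := eqVneq s (b i); rewrite ?si ?eqxx in rb.
  have -> : s' = ~~ b j by case: (s') (b j) rb => [] [].
  by exists (delta i - delta j); [exists i, j|rewrite mulmxBl !delta_sign eps_opp si].
have -> : s' = b j by rewrite (negPf si) in rb; case: (s') (b j) rb => [] [].
have -> : s = ~~ b i by case: (s) (b i) si => [] [].
exists (delta j - delta i); first by exists j, i; rewrite eq_sym.
by rewrite mulmxBl !delta_sign eps_opp addrC.
Qed.

Lemma Aroots_typeA b : is_typeA (Aroots b).
Proof.
exists (sign_mx b); split; first by case/mulmx1_unit: (sign_mx_sqr b).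
  exact: Aroots_stdA.
by move=> u v _ _; exact: cartan_sign.
Qed.

Lemma dotv_delta u i : dotv u (delta i) = u 0 i.
Proof.
rewrite /dotv trmx_delta mxE (bigD1 i) //= big1 ?addr0.
  by rewrite mxE !eqxx mulr1.
by move=> j /negPf ji; rewrite mxE ji mulr0.
Qed.

(** The reflection in e_k - e_m exchanges these two basis vectors. *)
Lemma stdA_reflection u v : stdA u -> stdA v -> stdA (u - cartan u v *: v).
Proof.
move=> [i [j [ij ->]]] [k [m [km ->]]]; set v0 := delta k - delta m.
have dotE w : dotv w v0 = w 0 k - w 0 m.
  by rewrite -!dotv_delta /dotv /v0 linearB mulmxBr !mxE.
have vv : dotv v0 v0 = 2.
  by rewrite dotE !mxE !eqxx (negPf km) eq_sym (negPf km) subr0 sub0r opprK.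
have -> : cartan (delta i - delta j) v0 = dotv (delta i - delta j) v0.
  by rewrite /cartan vv mulrAC divff ?mul1r.
have reflE p : delta p - dotv (delta p) v0 *: v0 = delta (tperm k m p).
  rewrite dotE !mxE /= /v0; case: tpermP => [->|->|/eqP pk /eqP pm].
  - by rewrite eqxx eq_sym (negPf km) subr0 scale1r subKr.
  - by rewrite eqxx (negPf km) sub0r scaleN1r opprK addrC subrK.
  - by rewrite ![_ == p]eq_sym (negPf pk) (negPf pm) subrr scale0r subr0.
exists (tperm k m i), (tperm k m j); split; first by rewrite (inj_eq perm_inj).
have -> : dotv (delta i - delta j) v0 = dotv (delta i) v0 - dotv (delta j) v0.
  by rewrite /dotv mulmxBl !mxE.
by rewrite -!reflE scalerBl !opprB (addrC (_ *: _)) addrACA (addrC (- delta j)).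
Qed.

Lemma Aroots_subsystem b : is_root_subsystem (Aroots b).
Proof.
have inA r : r \in Aroots b -> exists2 u, stdA u & u *m sign_mx b = root_vec r.
  move=> rb; suff : [set v *m sign_mx b | v in @stdA l] (root_vec r) by [].
  by rewrite Aroots_stdA; exists r.
move=> r s /inA[u uA <-] /inA[v vA <-]; rewrite cartan_sign.
have : [set root_vec r | r in [set` Aroots b]]
    ((u - cartan u v *: v) *m sign_mx b).
  by rewrite -Aroots_stdA; exists (u - cartan u v *: v) => //; exact: stdA_reflection.
by case=> c cb cE; exists c => //; rewrite cE mulmxBl scalemxAl.
Qed.

End TypeA.

Section Products.
Variables (R : comPzRingType) (l : nat) (I : set R).
Hypothesis idI : is_ideal I.
Local Notation G := (spinGL R l).
Implicit Types (b c : 'I_l -> bool) (g x y : G) (H : set G).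

Lemma levi_sub_Epin b : levi b `<=` Epin R l.
Proof. by apply: generatedS => _ [r [t [_ ->]]]; exists r, t; rewrite inE. Qed.

Lemma Epin_subgroup : is_subgroup (Epin R l).
Proof. exact: generated_subgroup. Qed.

Lemma Epin_rel_normal : is_normal_in (Epin R l) (Epin_rel l I).
Proof.
apply: normal_closure_normal; first exact: Epin_subgroup.
apply: generated_min; first exact: Epin_subgroup.
by move=> _ [r [t [rD _ ->]]]; apply: mem_generated; exists r, t.
Qed.

Lemma levi_rel_sub_Epin_rel b : levi_rel b I `<=` Epin_rel l I.
Proof.
have [sgE EE EJ] := Epin_rel_normal; have [sgL LL LJ] := levi_rel_normal b idI.
suff sub : levi_rel b I `<=` levi_rel b I `&` Epin_rel l I by move=> x /sub[].
apply: normal_closure_min.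
  split; [exact: subgroupI|by move=> x [/LL]|].
  move=> g x bg [bx Ex]; split; first exact: LJ.
  by apply: EJ => //; exact: levi_sub_Epin bg.
have Ssub : [set g | exists r s, [/\ r \in Aroots b, I s & g = root_elt r s]]
    `<=` levi_rel b I `&` Epin_rel l I.
  move=> _ [r [s [rb Is ->]]].
  split; apply: mem_normal_closure; apply: mem_generated; exists r, s => //.
by apply: (generated_min _ Ssub); exact: subgroupI.
Qed.

Lemma regular_conj b g : levi b g ->
  forall c, regularly_embedded_A I (conjg_set g (levi_rel c I)).
Proof.
move=> bg c; exists g, (Aroots c); split=> //; first exact: levi_sub_Epin bg.
  exact: Aroots_subsystem.
exact: Aroots_typeA.
Qed.

Lemma regular_levi_rel b : regularly_embedded_A I (levi_rel b I).
Proof.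
have [L1 _ _] := levi_subgroup R b.
have <- : conjg_set 1%g (levi_rel b I) = levi_rel b I; last exact: regular_conj L1 b.
apply/seteqP; split=> [_ [x bx <-]|x bx]; first by rewrite invg1 mulg1 mul1g.
by exists x => //; rewrite invg1 mulg1 mul1g.
Qed.

Lemma conj_levi_rel_sub b g c : levi b g ->
  conjg_set g (levi_rel c I) `<=` Epin_rel l I.
Proof.
have [_ _ EJ] := Epin_rel_normal; move=> bg _ [x cx <-].
by apply: EJ; [exact: levi_sub_Epin bg|exact: levi_rel_sub_Epin_rel cx].
Qed.

End Products.

Theorem theorem2 (R : comPzRingType) (I : set R) (l : nat)
  (hI : is_ideal I) (hsr : sr_le I 2) (hl : (4 <= l)%N) :
  exists2 m : nat, (m <= 9)%N &
  exists2 H : 'I_m -> set (spinGL R l),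
    (forall i, regularly_embedded_A I (H i)) &
    Epin_rel l I = \big[@mulg_set (spinGL R l)/[set 1%g]%classic]_(i < m) H i.
Proof.
have sr := sr_le_SR2 hI hsr.
pose n : 'I_l := Ordinal (leq_trans (isT : 0 < 4)%N hl).
pose b (i : 'I_l) := false; pose c (i : 'I_l) := b i (+) (i == n).
have bc : flipped n b c by [].
have [g1 [c1 [cg1 sub1]]] := radical_sub_two hI c.
have [g2 [c2 [bg2 sub2]]] := radical_sub_two hI (negb_fun b).
have [g3 [c3 [bg3 sub3]]] := radical_sub_two hI b.
pose J g d : set (spinGL R l) := conjg_set g (levi_rel d I).
pose Hs : seq (set (spinGL R l)) := [:: levi_rel c I; levi_rel c1 I; J g1 c1;
  levi_rel c2 I; J g2 c2; levi_rel b I; levi_rel c3 I; J g3 c3].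
(* The factors cover in turn the parabolic subgroup of c, the corner and the
   parabolic subgroup of b. *)
exists 8 => //; exists (fun i => nth set0 Hs i).
  case=> -[|[|[|[|[|[|[|[|//]]]]]]]] /= _; try exact: regular_levi_rel.
  - exact: regular_conj cg1 c1.
  - exact: regular_conj bg2 c2.
  - exact: regular_conj bg3 c3.
rewrite !big_ord_recl big_ord0 /= mulg_set1.
apply/seteqP; split.
  apply: subset_trans (Epin_rel_big_cell hI sr bc) _.
  have : big_cell I b c `<=` mulg_set (mulg_set (mulg_set (levi_rel c I)
      (mulg_set (levi_rel c1 I) (J g1 c1))) (mulg_set (levi_rel c2 I) (J g2 c2)))
      (mulg_set (levi_rel b I) (mulg_set (levi_rel c3 I) (J g3 c3))).
    apply: mulg_setS; last exact: mulg_setS.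
    apply: mulg_setS; first exact: mulg_setS.
    by move=> x [/sub2].
  by rewrite -!mulg_setA.
have [sgE _ _] := Epin_rel_normal l I.
have subL d : levi_rel d I `<=` Epin_rel l I := levi_rel_sub_Epin_rel hI (b := d).
have subJ d e g : levi d g -> J g e `<=` Epin_rel l I := @conj_levi_rel_sub _ _ _ hI d g e.
apply: (mulg_set_sub sgE (subL _)); apply: (mulg_set_sub sgE (subL _)).
apply: (mulg_set_sub sgE (subJ _ _ _ cg1)); apply: (mulg_set_sub sgE (subL _)).
apply: (mulg_set_sub sgE (subJ _ _ _ bg2)); apply: (mulg_set_sub sgE (subL _)).
exact: (mulg_set_sub sgE (subL _) (subJ _ _ _ bg3)).
Qed.
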